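(* (Correctness of the input PORK algorithm for strictly proper DAEs.) Let $(E,A,B,C)$ be a realization of an asymptotically stable DAE system with regular pencil $\lambda E-A$, $E,A\in\mathbb{R}^{n\times n}$, $B\in\mathbb{R}^{n\times m}$, $C\in\mathbb{R}^{p\times n}$, whose transfer function $G(s)=C(sE-A)^{-1}B$ is strictly proper. Let $S\in\mathbb{C}^{q\times q}$ and $R\in\mathbb{C}^{m\times q}$ represent right tangential interpolation data with all eigenvalues of $S$ in the open right half-plane; that is, $S$ is diagonalizable with distinct eigenvalues $\sigma_1,\dots,\sigma_q$, $\operatorname{Re}\sigma_i>0$, and for a nonsingular $T\in\mathbb{C}^{q\times q}$ with $TST^{-1}=\operatorname{diag}(\sigma_1,\dots,\sigma_q)$ all columns of $RT^{-1}$ are nonzero. Let $V\in\mathbb{C}^{n\times q}$ be the solution of the Sylvester equation $$AV-EVS-BR=0,$$ and let $\Gamma$ be the (unique, Hermitian positive definite) solution of the Lyapunov equation $$S^{*}\Gamma+\Gamma S-R^{*}R=0 .$$ Define $$E_r=\Gamma,\qquad A_r=-S^{*}\Gamma,\qquad B_r=-R^{*},\qquad C_r=CV .$$ Then $G_r(s)=C_r(sE_r-A_r)^{-1}B_r$ is the unique $\mathcal{H}_2$ pseudo-optimal reduced transfer function for $G$ with respect to $\mathcal{G}(-S^{*},R^{*})$.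
   Context: A DAE system with realization $(E,A,B,C)$ is $E\dot x(t)=Ax(t)+Bu(t)$, $y(t)=Cx(t)$, with $E$ possibly singular. The pencil $\lambda E-A$ is regular if $\det(\lambda E-A)\not\equiv0$; the system is asymptotically stable if all finite generalized eigenvalues of $\lambda E-A$ have negative real part. A rational matrix function is strictly proper if it tends to $0$ as $s\to\infty$. $^{*}$ denotes the conjugate transpose. $\mathcal{H}_2$ is the space of $p\times m$ rational matrix functions (complex coefficients allowed) that are analytic in the closed right half-plane and square integrable on the imaginary axis, with inner product $\langle F,H\rangle_{\mathcal{H}_2}=\frac{1}{2\pi}\int_{-\infty}^{\infty}\operatorname{tr}(F(\imath\omega)H(\imath\omega)^{*})\,d\omega$ and induced norm $\|\cdot\|_{\mathcal{H}_2}$. For a diagonalizable $A_M\in\mathbb{C}^{q\times q}$ with all eigenvalues in the open left half-plane and $B_M\in\mathbb{C}^{q\times m}$, $$\mathcal{G}(A_M,B_M)=\left\{G_M \;:\; \exists\, C_M\in\mathbb{C}^{p\times q},\ G_M(s)=C_M(sI_q-A_M)^{-1}B_M\right\}\subset\mathcal{H}_2 .$$ $G_r$ is called $\mathcal{H}_2$ pseudo-optimal with respect to $\mathcal{G}(A_M,B_M)$ if $G_r\in\mathcal{G}(A_M,B_M)$ and $\|G-G_r\|_{\mathcal{H}_2}=\min_{G_M\in\mathcal{G}(A_M,B_M)}\|G-G_M\|_{\mathcal{H}_2}$. *)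

(* Defs.v *)
From HB Require Import structures.
From mathcomp Require Import all_boot all_order all_algebra.
From mathcomp Require Import fraction sesquilinear spectral complex.
From mathcomp Require Import all_classical all_reals all_analysis.

Set Implicit Arguments.
Unset Strict Implicit.
Unset Printing Implicit Defensive.

Import Order.TTheory GRing.Theory Num.Theory numFieldNormedType.Exports.

Local Open Scope classical_set_scope.
Local Open Scope ring_scope.
Local Open Scope complex_scope.
Local Open Scope sesquilinear_scope.

(* The field C(s) of complex rational functions, with equality of rational
   functions (not of functions with junk values at the poles). *)
Notation ratfun K := {fraction {poly K[i]}}.

Section RationalFunctions.
Variable K : realType.
Implicit Types (f : ratfun K) (g : K[i] -> K[i]) (z : K[i]).

Definition ratfun_cst (a : K[i]) : ratfun K := FracField.tofrac a%:P.

Definition ratfun_var : ratfun K := FracField.tofrac 'X.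

(* The representative chosen by the quotient need not be in lowest terms, hence
   the division by the gcd: a removable singularity must not count as a pole. *)
Definition ratfun_num f : {poly K[i]} :=
  let nd := frac (repr f) in nd.1 %/ gcdp nd.1 nd.2.

Definition ratfun_den f : {poly K[i]} :=
  let nd := frac (repr f) in nd.2 %/ gcdp nd.1 nd.2.

(* Since x / 0 = 0, the value at a pole is 0. *)
Definition ratfun_eval f z : K[i] := (ratfun_num f).[z] / (ratfun_den f).[z].

Definition tends_to0_at_infinity g : Prop :=
  forall eps : K, 0 < eps ->
    exists M : K, forall z, M%:C < `|z| -> `|g z| < eps%:C.

(* Complex differentiable throughout a neighbourhood of z. *)
Definition analytic_at g z : Prop :=
  \forall w \near (z : K[i]^o), derivable (g : K[i]^o -> K[i]^o) w 1.

End RationalFunctions.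

Section RationalMatrices.
Variables (K : realType) (p m : nat).
Implicit Types F H : 'M[ratfun K]_(p, m).

Definition mxeval F (z : K[i]) : 'M[K[i]]_(p, m) :=
  map_mx (fun f => ratfun_eval f z) F.

Definition strictly_proper F : Prop :=
  forall i j, tends_to0_at_infinity (fun z => mxeval F z i j).

Definition h2_integrand F H (w : K) : K[i] :=
  \tr (mxeval F (0 +i* w) *m (mxeval H (0 +i* w))^t*).

(* tr (F F^* ) is real: it is the squared Frobenius norm of F. *)
Definition H2 : set 'M[ratfun K]_(p, m) :=
  [set F | (forall i j (z : K[i]), 0 <= complex.Re z ->
              analytic_at (fun s => mxeval F s i j) z) /\
           (@lebesgue_measure K).-integrable setT
              (fun w : K => (complex.Re (h2_integrand F F w))%:E)].

Definition h2_inner F H : K[i] :=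
  ((2 * pi)^-1)%:C *
  ((\int[@lebesgue_measure K]_(w in setT) complex.Re (h2_integrand F H w)) +i*
   (\int[@lebesgue_measure K]_(w in setT) complex.Im (h2_integrand F H w))).

Definition h2_norm F : K := Num.sqrt (complex.Re (h2_inner F F)).

End RationalMatrices.

Section Systems.
Variable K : realType.

Definition regular_pencil n (E A : 'M[K[i]]_n) : Prop :=
  \det ('X *: map_mx polyC E - map_mx polyC A) != 0.

Definition generalized_eigenvalue n (E A : 'M[K[i]]_n) (l : K[i]) : Prop :=
  exists2 x : 'cV[K[i]]_n, x != 0 & A *m x = l *: (E *m x).

Definition asymptotically_stable n (E A : 'M[K[i]]_n) : Prop :=
  forall l, generalized_eigenvalue E A l -> complex.Re l < 0.

(* C (s E - A)^-1 B, computed over the field C(s): the inverse there is genuine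
   exactly when the pencil is regular. *)
Definition transfer n m p (E A : 'M[K[i]]_n) (B : 'M[K[i]]_(n, m))
    (C : 'M[K[i]]_(p, n)) : 'M[ratfun K]_(p, m) :=
  let cst k l (M : 'M[K[i]]_(k, l)) := map_mx (@ratfun_cst K) M in
  cst _ _ C *m invmx (ratfun_var K *: cst _ _ E - cst _ _ A) *m cst _ _ B.

(* The family is considered for A_M diagonalizable with its spectrum in the open
   left half-plane; that restriction only serves to place it inside H2. *)
Definition G_family p q m (AM : 'M[K[i]]_q) (BM : 'M[K[i]]_(q, m)) :
    set 'M[ratfun K]_(p, m) :=
  [set GM | exists CM : 'M[K[i]]_(p, q), GM = transfer 1%:M AM BM CM].

(* h2_norm is a total function that is only meaningful on H2; the first two
   conditions ensure that all the error systems compared below belong to H2. *)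
Definition h2_pseudo_optimal p q m (G : 'M[ratfun K]_(p, m))
    (AM : 'M[K[i]]_q) (BM : 'M[K[i]]_(q, m)) (Gr : 'M[ratfun K]_(p, m)) : Prop :=
  [/\ H2 G,
      G_family AM BM `<=` @H2 K p m,
      G_family AM BM Gr &
      forall GM, G_family AM BM GM -> h2_norm (G - Gr) <= h2_norm (G - GM)].

End Systems.

(* Main.v *)
Require Import Defs.
From mathcomp Require Import all_boot all_order all_algebra.
From mathcomp Require Import fraction sesquilinear spectral complex.
From mathcomp Require Import all_classical all_reals all_analysis.
From mathcomp Require Import measurable_realfun zify ring lra.
Set Implicit Arguments.
Unset Strict Implicit.
Unset Printing Implicit Defensive.
Import Order.TTheory GRing.Theory Num.Theory.
Local Open Scope ring_scope.
Local Open Scope complex_scope.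
Local Open Scope sesquilinear_scope.

(** The family of competitors is a complex vector space of rational matrices
    with the prescribed simple poles -conj(sigma_k): diagonalizing S turns each
    member into a sum over k of c_k r_k^* / (s + conj(sigma_k)), where r_k is
    the k-th column of R T^-1 and c_k is free (residue_mx_family, residue_mxE).
    So Gr is the orthogonal projection of G onto the family as soon as G - Gr
    is orthogonal to the family, and Pythagoras (h2_real_inner_pythagoras) with
    the definiteness of the norm (h2_real_inner_definite) gives both optimality
    and uniqueness.

    Orthogonality is a consequence of interpolation. On the imaginary axis the
    conjugate of 1 / (s + conj(sigma_k)) is 1 / (sigma_k - s), so pairing F with
    a member of the family integrates multiples of F(s) r_k / (sigma_k - s).
    If F(sigma_k) r_k = 0 this quotient has no pole in the closed right
    half-plane and decays like s^-2, hence its integral vanishes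
    (Rintegral_imaginary_axis, h2_real_inner_residue).

    The matrices of the algorithm are chosen to make G - Gr vanish at sigma_k
    along r_k. With t_k the k-th column of T^-1, the Sylvester equation
    gives G(sigma_k) r_k = - C V t_k, and the Lyapunov equation, which is a
    Sylvester equation with solution the identity for the reduced realization,
    gives Gr(sigma_k) r_k = - C_r t_k (transfer_tangential in both cases).
    Finally Gr belongs to the family because Gamma can be cancelled from E_r and
    A_r; Gamma is nonsingular because its kernel is invariant under S and
    annihilated by R, while no eigenvector of S is (lyapunov_unit). *)

(** * Complex numbers *)

Section ComplexParts.
Variable K : realType.
Local Notation C := K[i].

Lemma ReD (x y : C) : complex.Re (x + y) = complex.Re x + complex.Re y.
Proof. by case: x y => [? ?] [? ?]. Qed.

Lemma ImD (x y : C) : complex.Im (x + y) = complex.Im x + complex.Im y.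
Proof. by case: x y => [? ?] [? ?]. Qed.

Lemma ReM (x y : C) : complex.Re (x * y) =
  complex.Re x * complex.Re y - complex.Im x * complex.Im y.
Proof. by case: x y => [? ?] [? ?]. Qed.

Lemma ImM (x y : C) : complex.Im (x * y) =
  complex.Re x * complex.Im y + complex.Im x * complex.Re y.
Proof. by case: x y => [? ?] [? ?]. Qed.

Lemma Re_sum (I : Type) (r : seq I) (x : I -> C) :
  complex.Re (\sum_(i <- r) x i) = \sum_(i <- r) complex.Re (x i).
Proof.
by elim: r => [|i r ih]; rewrite ?big_nil // !big_cons ReD ih.
Qed.

Lemma conjC_conjc (x : C) : Num.conj x = (x^*)%C.
Proof. by []. Qed.

Lemma ReMconj (x y : C) : complex.Re (x * Num.conj y) =
  complex.Re x * complex.Re y + complex.Im x * complex.Im y.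
Proof. by case: x y => [a b] [c d] /=; rewrite mulrN opprK. Qed.

Lemma Re_mulconj_ge0 (x : C) : 0 <= complex.Re (x * Num.conj x).
Proof. by rewrite ReMconj -!expr2 addr_ge0 ?sqr_ge0. Qed.

Lemma normc_ge_Im (x : C) : `|complex.Im x|%:C <= `|x|.
Proof.
have -> : complex.Im x = - complex.Re (x * (0 +i* 1)) 
  by rewrite ReM /= mulr0 mulr1 sub0r opprK.
rewrite normrN; apply: le_trans (normc_ge_Re _) _; rewrite normrM.
have -> : `|(0 +i* 1)| = 1 :> C by rewrite normc_def /= expr0n /= add0r expr1n sqrtr1.
by rewrite mulr1.
Qed.

Lemma conj_add_neq0 (x y : C) :
  0 < complex.Re x -> 0 < complex.Re y -> Num.conj x + y != 0.
Proof.
case: x y => a b [c d] /= a0 c0; rewrite eq_complex /= negb_and.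
by rewrite gt_eqF // addr_gt0.
Qed.

End ComplexParts.

(** * Values, stability and degree of rational functions *)

Section RatfunEval.
Variable K : realType.
Local Notation C := K[i].
Local Notation "p %:F" := (FracField.tofrac p).
Implicit Types (f g : ratfun K) (z v w : C) (P Q : {poly C}).

Lemma ratfun_reprE f : f = (frac (repr f)).1%:F / (frac (repr f)).2%:F.
Proof.
apply: (canRL (mulfK _)); first by rewrite tofrac_eq0 denom_ratioP.
rewrite -{1}[f]generic_quotient.reprK; unlock FracField.tofrac.
rewrite -[LHS]FracField.pi_mul; apply/generic_quotient.eqmodP/eqP => /=.
rewrite /FracField.mulf !numden_Ratio ?mulf_neq0 ?oner_eq0 ?denom_ratioP //.
by rewrite !mulr1 mulrC.
Qed.

Lemma ratfun_den_neq0 f : ratfun_den f != 0.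
Proof.
rewrite /ratfun_den dvdp_div_eq0 ?dvdp_gcdr //; exact: denom_ratioP.
Qed.

Lemma ratfun_numdenE f : f = (ratfun_num f)%:F / (ratfun_den f)%:F.
Proof.
have := ratfun_reprE f; have := ratfun_den_neq0 f; rewrite /ratfun_num /ratfun_den.
set n := (frac _).1; set d := (frac _).2 => hd ->.
have d0 : d != 0 by exact: denom_ratioP.
apply/eqP; rewrite eqr_div ?tofrac_eq0 // -!tofracM tofrac_eq.
apply/eqP; apply: (@mulIf _ (gcdp n d)); first by rewrite gcdp_eq0 negb_and d0 orbT.
by rewrite -mulrA (divpK (dvdp_gcdr n d)) mulrAC (divpK (dvdp_gcdl n d)).
Qed.

Lemma coprimep_ratfun f : coprimep (ratfun_num f) (ratfun_den f).
Proof.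
by rewrite /ratfun_num /ratfun_den coprimep_div_gcd ?denom_ratioP ?orbT.
Qed.

(** A relational form of evaluation at a point that is not a pole. Unlike
    [ratfun_eval], it is compatible with the field operations. *)
Definition has_value f z v :=
  exists P Q, [/\ Q.[z] != 0, f = P%:F / Q%:F & v = P.[z] / Q.[z]].

Lemma horner_neq0 Q z : Q.[z] != 0 -> Q != 0.
Proof. by apply: contra_neq => ->; rewrite horner0. Qed.

(** Lowest terms: the reduced denominator divides every other one, so a value
    can be read off any representation whose denominator does not vanish. *)
Lemma ratfun_den_dvd P Q : Q != 0 -> ratfun_den (P%:F / Q%:F) %| Q.
Proof.
move=> Q0; set f := _ / _.
have := ratfun_numdenE f => /eqP.
rewrite {1}/f eqr_div ?tofrac_eq0 ?ratfun_den_neq0 // -!tofracM tofrac_eq => /eqP e.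
have : ratfun_den f %| ratfun_num f * Q by rewrite -e dvdp_mull.
by rewrite Gauss_dvdpr // coprimep_sym coprimep_ratfun.
Qed.

Lemma has_value_den f z v : has_value f z v -> (ratfun_den f).[z] != 0.
Proof.
move=> [P [Q [Qz -> _]]]; apply/eqP => e.
have /dvdpP [D De] := ratfun_den_dvd P (horner_neq0 Qz).
by move: Qz; rewrite De hornerM e mulr0 eqxx.
Qed.

Lemma has_value_eval f z v : has_value f z v -> ratfun_eval f z = v.
Proof.
move=> h; have := has_value_den h; move: h => [P [Q [Qz fE ->]]] dz.
have /eqP := ratfun_numdenE f.
rewrite {1}fE eqr_div ?tofrac_eq0 ?(horner_neq0 Qz) ?ratfun_den_neq0 //.
rewrite -!tofracM tofrac_eq => /eqP/(congr1 (horner^~ z)).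
rewrite !hornerM /ratfun_eval => e.
by apply/esym/eqP; rewrite eqr_div // e.
Qed.

Lemma has_valueD f g z v w :
  has_value f z v -> has_value g z w -> has_value (f + g) z (v + w).
Proof.
move=> [P [Q [Qz -> ->]]] [P' [Q' [Qz' -> ->]]].
exists (P * Q' + P' * Q), (Q * Q').
rewrite !hornerD !hornerM mulf_neq0 //; split=> //; last by rewrite addf_div.
by rewrite addf_div ?tofrac_eq0 ?(horner_neq0 Qz) ?(horner_neq0 Qz') //
  !tofracD !tofracM.
Qed.

Lemma has_valueM f g z v w :
  has_value f z v -> has_value g z w -> has_value (f * g) z (v * w).
Proof.
move=> [P [Q [Qz -> ->]]] [P' [Q' [Qz' -> ->]]].
exists (P * P'), (Q * Q').
by rewrite !hornerM mulf_neq0 // !tofracM !mulf_div.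
Qed.

Lemma has_value_cst c z : has_value (ratfun_cst c) z c.
Proof.
by exists c%:P, 1; rewrite hornerC oner_eq0 hornerC tofrac1 !divr1.
Qed.

Lemma ratfun_cstN1 : ratfun_cst (-1 : C) = -1.
Proof. by rewrite /ratfun_cst polyCN tofracN tofrac1. Qed.

Lemma has_valueN f z v : has_value f z v -> has_value (- f) z (- v).
Proof.
move=> h; rewrite -mulN1r -ratfun_cstN1 -(mulN1r v).
by apply: has_valueM => //; exact: has_value_cst.
Qed.

Lemma has_valueB f g z v w :
  has_value f z v -> has_value g z w -> has_value (f - g) z (v - w).
Proof. by move=> ? ?; apply/has_valueD/has_valueN. Qed.

Lemma has_value_sum (I : Type) (r : seq I) (f : I -> ratfun K) z (v : I -> C) :
  (forall i, has_value (f i) z (v i)) ->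
  has_value (\sum_(i <- r) f i) z (\sum_(i <- r) v i).
Proof.
move=> h; elim: r => [|i r ih]; last by rewrite !big_cons; apply: has_valueD.
by rewrite !big_nil -tofrac0; exact: has_value_cst.
Qed.

Definition stable_poly Q := forall z, root Q z -> complex.Re z < 0.

Lemma stable_poly_neq0 Q : stable_poly Q -> Q != 0.
Proof.
move=> h; apply/eqP => e; have := h 0; rewrite e root0 /= ltxx => /(_ isT) //.
Qed.

Lemma stable_polyM P Q : stable_poly P -> stable_poly Q -> stable_poly (P * Q).
Proof. by move=> hP hQ z; rewrite rootM => /orP [/hP|/hQ]. Qed.

Lemma stable_poly_horner Q z : stable_poly Q -> 0 <= complex.Re z -> Q.[z] != 0.
Proof. by move=> h z0; apply/negP => /h; rewrite ltNge z0. Qed.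

Lemma stable_polyXsubC (a : C) : complex.Re a < 0 -> stable_poly ('X - a%:P).
Proof. by move=> ha z; rewrite root_XsubC => /eqP ->. Qed.

(** Bounds the relative degree from below by [d]. For the zero numerator the
    predecessor of the size is 0, and the class is still closed under products
    because zero is then represented over a denominator of degree at least
    [d]. *)
Definition stable_ratfun (d : nat) f :=
  exists P Q, [/\ stable_poly Q, ((size P).-1 + d < size Q)%N & f = P%:F / Q%:F].

Lemma stable_ratfun_value d f z : stable_ratfun d f -> 0 <= complex.Re z ->
  has_value f z (ratfun_eval f z).
Proof.
move=> [P [Q [hQ _ ->]]] z0.
have h : has_value (P%:F / Q%:F) z (P.[z] / Q.[z]).
  by exists P, Q; split=> //; exact: stable_poly_horner.
by rewrite (has_value_eval h).
Qed.

Lemma stable_ratfunD d f g :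
  stable_ratfun d f -> stable_ratfun d g -> stable_ratfun d (f + g).
Proof.
move=> [P [Q [hQ s ->]]] [P' [Q' [hQ' s' ->]]].
have Q0 := stable_poly_neq0 hQ; have Q0' := stable_poly_neq0 hQ'.
exists (P * Q' + P' * Q), (Q * Q'); split; first exact: stable_polyM.
  have := size_polyD (P * Q') (P' * Q); have := size_polyMleq P Q'.
  have := size_polyMleq P' Q; rewrite (size_mul Q0 Q0').
  rewrite -size_poly_gt0 in Q0; rewrite -size_poly_gt0 in Q0'.
  move: s s' Q0 Q0'.
  move: (size P) (size P') (size Q) (size Q').
  move: (size (P' * Q : {poly C})) (size (P * Q' : {poly C})).
  move: (size (P * Q' + P' * Q : {poly C})).
  lia.
by rewrite addf_div ?tofrac_eq0 ?stable_poly_neq0 // tofracD !tofracM.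
Qed.

Lemma stable_ratfunM d d' f g :
  stable_ratfun d f -> stable_ratfun d' g -> stable_ratfun (d + d') (f * g).
Proof.
move=> [P [Q [hQ s ->]]] [P' [Q' [hQ' s' ->]]].
have Q0 := stable_poly_neq0 hQ; have Q0' := stable_poly_neq0 hQ'.
exists (P * P'), (Q * Q'); split; first exact: stable_polyM.
  have := size_polyMleq P P'; rewrite (size_mul Q0 Q0').
  rewrite -size_poly_gt0 in Q0; rewrite -size_poly_gt0 in Q0'.
  move: s s' Q0 Q0'.
  move: (size P) (size P') (size Q) (size Q') (size (P * P' : {poly C})).
  lia.
by rewrite mulf_div !tofracM.
Qed.

Lemma stable_ratfun_cst c : stable_ratfun 0 (ratfun_cst c).
Proof.
exists c%:P, 1; split.
- by move=> z; rewrite rootC oner_eq0.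
- by rewrite size_poly1 addn0; have := size_polyC_leq1 c; case: (size _) => [|[]].
- by rewrite tofrac1 divr1.
Qed.

Lemma stable_ratfun_cstM d c f :
  stable_ratfun d f -> stable_ratfun d (ratfun_cst c * f).
Proof.
by rewrite -{2}[d]add0n => ?; apply: stable_ratfunM => //; exact: stable_ratfun_cst.
Qed.

Lemma stable_ratfunN d f : stable_ratfun d f -> stable_ratfun d (- f).
Proof. by rewrite -mulN1r -ratfun_cstN1; exact: stable_ratfun_cstM. Qed.

Lemma stable_polyXn1 d : stable_poly (('X - (- 1)%:P) ^+ d).
Proof.
elim: d => [|d ih]; first by rewrite expr0 => z; rewrite rootC oner_eq0.
by rewrite exprS; apply: stable_polyM => //; apply: stable_polyXsubC; rewrite /= ltrN10.
Qed.

Lemma stable_ratfun0 d : stable_ratfun d 0.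
Proof.
exists 0, (('X - (- 1)%:P) ^+ d); split; first exact: stable_polyXn1.
  by rewrite size_poly0 size_exp_XsubC.
by rewrite tofrac0 mul0r.
Qed.

Lemma stable_ratfun_sum d (I : Type) (r : seq I) (f : I -> ratfun K) :
  (forall i, stable_ratfun d (f i)) -> stable_ratfun d (\sum_(i <- r) f i).
Proof.
move=> h; elim: r => [|i r ih]; last by rewrite big_cons; apply: stable_ratfunD.
by rewrite big_nil; exact: stable_ratfun0.
Qed.

Lemma stable_ratfun_XsubC (a : C) : complex.Re a < 0 ->
  stable_ratfun 1 (('X - a%:P)%:F)^-1.
Proof.
move=> ha; exists 1, ('X - a%:P); split; first exact: stable_polyXsubC.
  by rewrite size_poly1 size_XsubC.
by rewrite tofrac1 div1r.
Qed.

Lemma has_value_XsubC (a z : C) : z != a ->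
  has_value (('X - a%:P)%:F)^-1 z (z - a)^-1.
Proof.
move=> za; exists 1, ('X - a%:P).
split; first by rewrite hornerXsubC subr_eq0.
  by rewrite tofrac1 div1r.
by rewrite hornerXsubC hornerC div1r.
Qed.

(** A zero in the right half-plane can be divided out without creating a pole
    there, and the division gains one degree of decay. *)
Lemma stable_ratfun_div_zero d f (a : C) : 0 <= complex.Re a ->
  stable_ratfun d f -> ratfun_eval f a = 0 ->
  stable_ratfun d.+1 (f / ('X - a%:P)%:F).
Proof.
move=> ha [P [Q [hQ s ->]]] fa.
have Qa := stable_poly_horner hQ ha.
have hv : has_value (P%:F / Q%:F) a (P.[a] / Q.[a]) by exists P, Q.
move: fa; rewrite (has_value_eval hv) => /eqP; rewrite mulf_eq0 invr_eq0 (negPf Qa) orbF.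
move=> /factor_theorem [P' e].
have [P0|P0] := eqVneq P 0.
  by rewrite P0 tofrac0 !mul0r; exact: stable_ratfun0.
have P'0 : P' != 0 by apply: contra_neq P0 => h; rewrite e h mul0r.
have X0 : 'X - a%:P != 0 by rewrite polyXsubC_eq0.
exists P', Q; split=> //.
  move: s; rewrite e size_Mmonic ?monicXsubC // size_XsubC.
  have : (0 < size P')%N by rewrite size_poly_gt0.
  move: (size P') (size Q) => *; lia.
by rewrite e tofracM mulrAC mulfK // tofrac_eq0.
Qed.

End RatfunEval.

(** * Growth of complex polynomials *)

Section PolynomialGrowth.
Variable K : realType.
Local Notation C := K[i].
Implicit Types (P Q : {poly C}) (z a : C).

Lemma poly_growth P : exists2 M : C, 0 <= M &
  forall z, `|P.[z]| <= M * (1 + `|z|) ^+ (size P).-1.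
Proof.
exists (\sum_(i < size P) `|P`_i|); first exact: sumr_ge0.
move=> z; rewrite horner_coef mulr_suml.
apply: le_trans (ler_norm_sum _ _ _) _; apply: ler_sum => i _.
rewrite normrM normrX ler_wpM2l //.
apply: (@le_trans _ _ ((1 + `|z|) ^+ i)).
  by rewrite lerXn2r ?nnegrE ?addr_ge0 // lerDr.
by rewrite ler_weXn2l ?lerDl //; case: (size P) i => [[]|n] //= i; rewrite -ltnS.
Qed.

Lemma prod_XsubC_lower (Omega : C -> Prop) (r : seq C) :
  (forall a, a \in r -> exists2 c : C, 0 < c &
     forall z, Omega z -> c * (1 + `|z|) <= `|z - a|) ->
  exists2 c : C, 0 < c & forall z, Omega z ->
    c * (1 + `|z|) ^+ size r <= `|(\prod_(a <- r) ('X - a%:P)).[z]|.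
Proof.
elim: r => [|a r ih] h.
  by exists 1 => // z _; rewrite big_nil hornerC normr1 expr0 mulr1.
have [|c c0 hc] := ih; first by move=> b br; apply: h; rewrite inE br orbT.
have [|c' c'0 hc'] := h a; first by rewrite inE eqxx.
exists (c' * c); first exact: mulr_gt0.
move=> z Oz; rewrite big_cons hornerM hornerXsubC normrM exprS mulrACA.
have h1 : 0 <= 1 + `|z| by rewrite addr_ge0.
by apply: ler_pM; rewrite ?hc ?hc' // mulr_ge0 ?exprn_ge0 // ltW.
Qed.

(** A lower bound for each linear factor on a region gives one for the whole
    polynomial, because polynomials over an algebraically closed field split. *)
Lemma poly_lower (Omega : C -> Prop) Q : Q != 0 ->
  (forall a, root Q a -> exists2 c : C, 0 < c &
     forall z, Omega z -> c * (1 + `|z|) <= `|z - a|) ->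
  exists2 c : C, 0 < c & forall z, Omega z ->
    c * (1 + `|z|) ^+ (size Q).-1 <= `|Q.[z]|.
Proof.
move=> Q0 h; have [r e] := closed_field_poly_normal Q.
have l0 : lead_coef Q != 0 by rewrite lead_coef_eq0.
have [|c c0 hc] := @prod_XsubC_lower Omega r.
  by move=> a ar; apply: h; rewrite e rootZ // root_prod_XsubC.
exists (`|lead_coef Q| * c); first by rewrite mulr_gt0 ?normr_gt0.
move=> z Oz; rewrite e hornerZ normrM size_scale ?size_prod_XsubC //=.
by rewrite lead_coefZ lead_coef_prod_XsubC mulr1 -mulrA ler_wpM2l // hc.
Qed.

Lemma poly_lower_infinity Q : Q != 0 -> exists R : K,
  exists2 c : C, 0 < c & forall z, R%:C <= `|z| ->
    c * (1 + `|z|) ^+ (size Q).-1 <= `|Q.[z]|.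
Proof.
move=> Q0; have [r e] := closed_field_poly_normal Q.
pose R : C := 1 + 2 * \sum_(a <- r) `|a|.
have R0 : 0 <= R by rewrite addr_ge0 // mulr_ge0 // sumr_ge0.
exists (complex.Re R); have -> : (complex.Re R)%:C = R.
  by apply: RRe_real; exact: ger0_real.
apply: poly_lower => // a; rewrite e rootZ ?lead_coef_eq0 // root_prod_XsubC => ar.
exists (2^-1) => [|z Rz]; first by rewrite invr_gt0.
rewrite ler_pdivrMl // -(lerD2r (2 * `|a|)).
have h1 : 2 * `|z| <= 2 * `|z - a| + 2 * `|a|.
  by rewrite -mulrDr ler_wpM2l //; have := ler_normD (z - a) a; rewrite subrK.
apply: le_trans h1; rewrite [leRHS]mulr_natl mulr2n addrAC lerD2r.
apply: le_trans Rz; rewrite lerD2l ler_wpM2l //.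
by rewrite (big_rem a) //= lerDl sumr_ge0.
Qed.

(** Finitely many roots stay away from the imaginary axis; this leaves room to
    differentiate across it. *)
Lemma stable_poly_margin Q : stable_poly Q ->
  exists2 delta : K, 0 < delta & forall a, root Q a -> complex.Re a <= - (2 * delta).
Proof.
move=> hQ; have Q0 := stable_poly_neq0 hQ.
have [r e] := closed_field_poly_normal Q.
have rQ a : root Q a = (a \in r).
  by rewrite e rootZ ?lead_coef_eq0 // root_prod_XsubC.
suff [delta d0 h] : exists2 delta : K, 0 < delta &
    forall a, a \in r -> complex.Re a <= - (2 * delta).
  by exists delta => // a; rewrite rQ; exact: h.
have : forall a, a \in r -> complex.Re a < 0 by move=> a; rewrite -rQ; exact: hQ.
elim: (r) => [|b s ih] h; first by exists 1.
have [|d d0 hd] := ih; first by move=> a sa; apply: h; rewrite inE sa orbT.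
have hb : complex.Re b < 0 by apply: h; rewrite inE eqxx.
exists (Num.min d (- complex.Re b / 2)).
  by rewrite lt_min d0 divr_gt0 // oppr_gt0.
move=> a; rewrite inE => /orP[/eqP ->|sa].
  have : Num.min d (- complex.Re b / 2) <= - complex.Re b / 2 by rewrite ge_min lexx orbT.
  lra.
have : Num.min d (- complex.Re b / 2) <= d by rewrite ge_min lexx.
have := hd a sa; lra.
Qed.

Lemma poly_lower_stable Q : stable_poly Q ->
  exists2 delta : K, 0 < delta & exists2 c : C, 0 < c &
    forall z, - delta <= complex.Re z -> c * (1 + `|z|) ^+ (size Q).-1 <= `|Q.[z]|.
Proof.
move=> hQ; have [delta d0 hd] := stable_poly_margin hQ.
exists delta => //; apply: poly_lower; first exact: stable_poly_neq0.
move=> a /hd ha.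
have dC : 0 < delta%:C by rewrite ltcR.
have c0 : 0 < 1 + (1 + `|a|) / delta%:C.
  by rewrite ltr_pwDl // divr_ge0 ?addr_ge0 // ltW.
exists (1 + (1 + `|a|) / delta%:C)^-1; first by rewrite invr_gt0.
move=> z hz; rewrite ler_pdivrMl //.
have hza : delta%:C <= `|z - a|.
  apply: le_trans (normc_ge_Re _); rewrite lecR.
  apply: le_trans (ler_norm _); move: ha hz; case: (z) (a) => [x y] [x' y'] /=; lra.
rewrite mulrDl mul1r.
have : 1 + `|z| <= `|z - a| + (1 + `|a|).
  rewrite addrCA lerD2l; have := ler_normD (z - a) a; by rewrite subrK.
move=> /le_trans; apply; rewrite lerD2l.
by rewrite -mulrA ler_peMr ?addr_ge0 // mulrC ler_pdivlMr // mul1r.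
Qed.

Lemma stable_ratio_bound d P Q : stable_poly Q -> ((size P).-1 + d < size Q)%N ->
  exists2 delta : K, 0 < delta & exists2 M : K, 0 <= M &
    forall z, - delta <= complex.Re z ->
      Q.[z] != 0 /\ `|P.[z] / Q.[z]| * (1 + `|z|) ^+ d <= M%:C.
Proof.
move=> hQ s; have [delta d0 [c c0 hc]] := poly_lower_stable hQ.
have [M M0 hM] := poly_growth P.
exists delta => //; exists (complex.Re (M / c)).
  by rewrite -ler0c RRe_real ?ger0_real // divr_ge0 // ltW.
move=> z /hc {}hc; rewrite RRe_real; last by rewrite ger0_real // divr_ge0 // ltW.
have z0 : 0 < 1 + `|z| by rewrite ltr_pwDl.
have Q0 : 0 < `|Q.[z]| by apply: lt_le_trans hc; rewrite mulr_gt0 // exprn_gt0.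
rewrite -normr_gt0 Q0; split=> //.
rewrite normrM normrV ?unitfE -?normr_gt0 // mulrAC ler_pdivrMr //.
apply: le_trans (_ : M * (1 + `|z|) ^+ (size Q).-1 <= _); last first.
  by rewrite mulrAC ler_pdivlMr // -mulrA ler_wpM2l // mulrC.
apply: le_trans (_ : M * (1 + `|z|) ^+ (size P).-1 * (1 + `|z|) ^+ d <= _).
  by rewrite ler_wpM2r // exprn_ge0 // ltW.
rewrite -mulrA -exprD ler_wpM2l // ler_weXn2l ?lerDl //.
by move: s; case: (size Q).
Qed.

End PolynomialGrowth.

Section StrictlyProper.
Variable K : realType.
Local Notation C := K[i].

(** Otherwise the numerator outgrows the denominator, and the quotient stays
    away from 0 at infinity. *)
Lemma strictly_proper_size (f : ratfun K) :
  tends_to0_at_infinity (ratfun_eval f) ->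
  ratfun_num f = 0 \/ (size (ratfun_num f) < size (ratfun_den f))%N.
Proof.
move=> h; have [->|N0] := eqVneq (ratfun_num f) 0; [by left|right].
have D0 := ratfun_den_neq0 f; move: h; rewrite /ratfun_eval.
move: (ratfun_num f) (ratfun_den f) N0 D0 => N D N0 D0 h.
rewrite ltnNge; apply/negP => s.
have [R [c c0 hc]] := poly_lower_infinity N0.
have [M M0 hM] := poly_growth D.
have M1 : 0 < M + 1 by rewrite ltr_wpDl.
have e0 : 0 < c / (M + 1) by rewrite divr_gt0.
have eE : (complex.Re (c / (M + 1)))%:C = c / (M + 1) by rewrite RRe_real // gtr0_real.
have [|M' hM'] := h (complex.Re (c / (M + 1))); first by rewrite -ltcR eE.
have [R' [c' c'0 hc']] := poly_lower_infinity D0.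
pose x := `|R| + `|R'| + `|M'| + 1; pose z : C := x%:C.
have x0 : 0 <= x by rewrite !addr_ge0.
have zE : `|z| = z by rewrite ger0_norm // ler0c.
have hR : R <= x /\ R' <= x /\ M' < x.
  have := ler_norm R; have := ler_norm R'; have := ler_norm M'; rewrite /x.
  have := normr_ge0 R; have := normr_ge0 R'; have := normr_ge0 M'; lra.
have := hM' z; rewrite zE ltcR eE hR.2.2 => /(_ isT) h3.
have := hc z; rewrite zE lecR hR.1 => /(_ isT) h1.
have := hc' z; rewrite zE lecR hR.2.1 => /(_ isT) h4.
have := hM z; rewrite zE => h2.
have z1 : 1 <= 1 + z by rewrite lerDl ler0c.
have z0 : 0 < 1 + z by exact: lt_le_trans z1.
have Dz : 0 < `|D.[z]| by apply: lt_le_trans h4; rewrite mulr_gt0 // exprn_gt0.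
move: h3; rewrite normrM normrV ?unitfE -?normr_gt0 // ltr_pdivrMr // => h3.
suff h5 : c / (M + 1) * `|D.[z]| <= `|N.[z]| by have := lt_le_trans h3 h5; rewrite ltxx.
apply: le_trans h1; apply: le_trans (_ : c / (M + 1) * (M * (1 + z) ^+ (size D).-1) <= _).
  by rewrite ler_wpM2l // ltW.
rewrite mulrA; apply: ler_pM.
- by rewrite mulr_ge0 // ltW.
- by rewrite exprn_ge0 // ltW.
- by rewrite mulrAC ler_pdivrMr // ler_pM2l // lerDl.
by rewrite ler_weXn2l // -!subn1 leq_sub2r.
Qed.

Lemma strictly_proper_stable (f : ratfun K) :
  tends_to0_at_infinity (ratfun_eval f) -> stable_poly (ratfun_den f) ->
  stable_ratfun 1 f.
Proof.
move=> /strictly_proper_size h hD.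
have [N0|N0] := eqVneq (ratfun_num f) 0.
  by rewrite (ratfun_numdenE f) N0 tofrac0 mul0r; exact: stable_ratfun0.
exists (ratfun_num f), (ratfun_den f); split; rewrite -?ratfun_numdenE //.
case: h => [/eqP|]; first by rewrite (negPf N0).
by move: N0; rewrite -size_poly_gt0 addn1; case: (size _).
Qed.
End StrictlyProper.

(** * Integrals over the real line *)

Section LineIntegrals.
Import numFieldNormedType.Exports.
Local Open Scope classical_set_scope.
Variable K : realType.
Local Notation mu := (@lebesgue_measure K).
Implicit Types (h v : K -> K) (M : K).

Lemma oneDsqr_gt0 (w : K) : 0 < oneDsqr w.
Proof. exact: lt_le_trans (oneDsqr_ge1 w). Qed.

Lemma integrable_oneDsqrV : mu.-integrable setT (EFin \o (fun w => (oneDsqr w)^-1)).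
Proof.
have cV : continuous (fun w : K => (oneDsqr w)^-1) by exact: continuous_oneDsqrV.
have V0 (w : K) : 0 <= (oneDsqr w)^-1 by rewrite invr_ge0 ltW.
apply/integrableP; split.
  by apply/measurable_EFinP; exact: continuous_measurable_fun.
under eq_integral do rewrite /= ger0_norm //.
rewrite ge0_symfun_integralT //; last by move=> w; rewrite /= /oneDsqr sqrrN.
by rewrite -set_itvcy integral0y_oneDsqr -EFinM ltry.
Qed.

Lemma integrable_dominated M h : continuous h ->
  (forall w, `|h w| <= M * (oneDsqr w)^-1) -> mu.-integrable setT (EFin \o h).
Proof.
move=> ch hM.
apply: (le_integrable _ _ _ (integrableZl _ M integrable_oneDsqrV)) => //.
  by apply/measurable_EFinP; exact: continuous_measurable_fun.
move=> w _; rewrite /= lee_fin; apply: le_trans (hM w) _; exact: ler_norm.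
Qed.

Lemma Rintegral_dominated_cvg (f_ : nat -> K -> K) (f g : K -> K) :
  (forall n, measurable_fun setT (f_ n)) -> measurable_fun setT f ->
  mu.-integrable setT (EFin \o g) ->
  (forall x, f_ n x @[n --> \oo] --> f x) ->
  (forall n x, `|f_ n x| <= g x) ->
  \int[mu]_(x in setT) f_ n x @[n --> \oo] --> \int[mu]_(x in setT) f x.
Proof.
move=> mf_ mf ig ff fg.
have [||||| i _ c] := @dominated_convergence _ _ _ mu setT measurableT
  (fun n => EFin \o f_ n) (EFin \o f) (EFin \o g).
- by move=> n; apply/measurable_EFinP; exact: mf_.
- by apply/measurable_EFinP.
- by apply: aeW => x _; apply: cvg_EFin; [exact: nearW|exact: ff].
- exact: ig.
- by apply: aeW => x n _; rewrite /= lee_fin.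
apply: fine_cvg; rewrite fineK //; exact: integrable_fin_num.
Qed.

Lemma is_derive_continuous v h : (forall w : K, is_derive w (1 : K) v (h w)) -> continuous v.
Proof. by move=> dv w; apply/differentiable_continuous/derivable1_diffP. Qed.

Lemma cvg_oneDsqrV (a : K^nat) : (forall n, n%:R <= `|a n|) ->
  (oneDsqr (a n))^-1 @[n --> \oo] --> (0:K).
Proof.
move=> ha; apply/cvgrPdist_lt => e e0; near=> n.
have p := oneDsqr_gt0 (a n).
rewrite sub0r normrN ger0_norm; last by rewrite invr_ge0 ltW.
rewrite invf_plt ?posrE //.
rewrite /oneDsqr -real_normK ?num_real //.
have h1 := ha n.
have h2 : e^-1 < n%:R by near: n; exact: nbhs_infty_gtr.
have : n%:R <= `|a n| ^+ 2 + 1.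
  by move: h1; move: `|_| (normr_ge0 (a n)) => x; nra.
by lra.
Unshelve. all: by end_near. Qed.

Lemma cvg_dominated M (a b : K^nat) : (forall n, `|b n| <= M * (oneDsqr (a n))^-1) ->
  (forall n, n%:R <= `|a n|) -> b n @[n --> \oo] --> (0 : K).
Proof.
move=> hM ha.
have c : M * (oneDsqr (a n))^-1 @[n --> \oo] --> (0 : K).
  by rewrite -(mulr0 M); apply: cvgM; [exact: cvg_cst|exact: cvg_oneDsqrV].
have c' : - (M * (oneDsqr (a n))^-1) @[n --> \oo] --> (0 : K).
  by rewrite -oppr0; apply: cvgN.
apply: squeeze_cvgr c' c.
by near=> n; rewrite /= -ler_norml; exact: hM.
Unshelve. all: by end_near. Qed.

(** The integral over [-n, n] is the difference of the primitive at the
    endpoints, which tends to 0. *)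
Lemma Rintegral_derivative M h v : (forall w : K, is_derive w (1 : K) v (h w)) ->
  continuous h -> (forall w, `|h w| <= M * (oneDsqr w)^-1) ->
  (forall w, `|v w| <= M * (oneDsqr w)^-1) ->
  \int[mu]_(w in setT) h w = 0.
Proof.
move=> dv ch hM vM.
have mh : measurable_fun setT h by exact: continuous_measurable_fun.
pose I n : set K := `[- n.+1%:R, n.+1%:R]%classic.
have mI n : measurable (I n) by exact: measurable_itv.
have c1 : \int[mu]_(w in setT) (h \_ (I n)) w @[n --> \oo] --> \int[mu]_(w in setT) h w.
  apply: (@Rintegral_dominated_cvg _ _ (fun w => M * (oneDsqr w)^-1)) => //.
  - by move=> n; apply/(measurable_restrictT _ (mI n)); exact: measurable_funTS.
  - exact: (integrableZl _ M integrable_oneDsqrV).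
  - move=> x; apply: cvg_near_cst; near=> n.
    rewrite patchE mem_set // /I /= in_itv /= -ler_norml.
    apply: (@le_trans _ _ n%:R); last by rewrite ler_nat.
    by near: n; exact: nbhs_infty_ger.
  - move=> n x; rewrite patchE; case: ifPn => // _.
    by rewrite normr0 (le_trans _ (hM x)).
have E n : \int[mu]_(w in setT) (h \_ (I n)) w = v n.+1%:R - v (- n.+1%:R).
  rewrite -Rintegral_mkcond /Rintegral (@continuous_FTC2 _ h v) //.
  - by rewrite (@lt_trans _ _ 0) ?oppr_lt0 ?ltr0Sn.
  - exact: continuous_subspaceT.
  - split; first by [].
    + by apply: cvg_at_right_filter; exact: (is_derive_continuous dv).
    + by apply: cvg_at_left_filter; exact: (is_derive_continuous dv).
  - by move=> x _; rewrite derive1E; exact: derive_val.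
have n1 n : n%:R <= `|n.+1%:R| :> K by rewrite ger0_norm // ler_nat.
have c2 : v n.+1%:R - v (- n.+1%:R) @[n --> \oo] --> (0 - 0 : K).
  apply: cvgB; first exact: (@cvg_dominated M (fun n => n.+1%:R)).
  by apply: (@cvg_dominated M (fun n => - n.+1%:R)) => // n; rewrite normrN.
rewrite subr0 in c2; move: c1; under eq_fun do rewrite E.
by move=> c1; have := cvg_unique _ c1 c2 => ->.
Unshelve. all: by end_near. Qed.
End LineIntegrals.

(** * Differentiation along lines in the complex plane *)

Section ComplexCurves.
Import numFieldNormedType.Exports.
Local Open Scope classical_set_scope.
Variable K : realType.
Local Notation C := K[i].
Implicit Types (c e : K -> C) (t : K).

(** Derivative of a complex-valued function of a real variable, in coordinates:
    the library calculus on the real line applies to each coordinate. *)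
Definition curve_derive c t (d : C) :=
  is_derive t (1 : K) (fun s => complex.Re (c s)) (complex.Re d) /\
  is_derive t (1 : K) (fun s => complex.Im (c s)) (complex.Im d).

Lemma curve_derive_eq c t d d' : curve_derive c t d -> d = d' -> curve_derive c t d'.
Proof. by move=> ? <-. Qed.

Lemma curve_derive_ext c c' t d : c =1 c' -> curve_derive c t d -> curve_derive c' t d.
Proof. by move=> /funext ->. Qed.

Lemma curve_derive_cst (a : C) t : curve_derive (fun=> a) t 0.
Proof. by split; exact: is_derive_cst. Qed.

Lemma curve_derive_horizontal (w t : K) : curve_derive (fun s => s +i* w) t 1.
Proof. by split; [exact: is_derive_id|exact: is_derive_cst]. Qed.

Lemma curve_derive_vertical (x t : K) : curve_derive (fun s => x +i* s) t 'i.
Proof. by split; [exact: is_derive_cst|exact: is_derive_id]. Qed.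

Lemma curve_deriveD c e t d d' : curve_derive c t d -> curve_derive e t d' ->
  curve_derive (fun s => c s + e s) t (d + d').
Proof.
move=> [c1 c2] [e1 e2]; split.
  by under eq_fun do rewrite ReD; rewrite ReD; exact: is_deriveD.
by under eq_fun do rewrite ImD; rewrite ImD; exact: is_deriveD.
Qed.

Lemma curve_deriveM c e t d d' : curve_derive c t d -> curve_derive e t d' ->
  curve_derive (fun s => c s * e s) t (d * e t + c t * d').
Proof.
move=> [c1 c2] [e1 e2]; split.
  under eq_fun do rewrite ReM; rewrite ReD !ReM.
  apply: (is_derive_eq (is_deriveB (is_deriveM c1 e1) (is_deriveM c2 e2))).
  by rewrite /GRing.scale /=; ring.
under eq_fun do rewrite ImM; rewrite ImD !ImM.
apply: (is_derive_eq (is_deriveD (is_deriveM c1 e2) (is_deriveM c2 e1))).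
by rewrite /GRing.scale /=; ring.
Qed.

Lemma curve_deriveV c t d : c t != 0 -> curve_derive c t d ->
  curve_derive (fun s => (c s)^-1) t (- (d * (c t)^-1 * (c t)^-1)).
Proof.
have ReV (x : C) : complex.Re x^-1 =
    complex.Re x * (complex.Re x * complex.Re x + complex.Im x * complex.Im x)^-1.
  by case: x => a b /=; rewrite -!expr2.
have ImV (x : C) : complex.Im x^-1 =
    - complex.Im x * (complex.Re x * complex.Re x + complex.Im x * complex.Im x)^-1.
  by case: x => a b /=; rewrite -!expr2 mulNr.
move=> ct [c1 c2].
have n0 : complex.Re (c t) * complex.Re (c t) + complex.Im (c t) * complex.Im (c t) != 0.
  move: ct; case: (c t) => a b; rewrite eq_complex /= negb_and -!expr2.
  by rewrite paddr_eq0 ?sqr_ge0 // !sqrf_eq0 negb_and.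
pose N : K -> K := fun s =>
  complex.Re (c s) * complex.Re (c s) + complex.Im (c s) * complex.Im (c s).
have dN : is_derive t (1 : K) N _ := is_deriveD (is_deriveM c1 c1) (is_deriveM c2 c2).
have {dN} dV := @is_deriveV _ N _ _ _ n0 dN.
have nE (x : C) : complex.Im (- x) = - complex.Im x /\ complex.Re (- x) = - complex.Re x.
  by case: x.
split.
  under eq_fun do rewrite ReV.
  apply: (is_derive_eq (is_deriveM c1 dV)).
  rewrite (nE _).2 !(ReM, ImM) ReV ImV /GRing.scale /= /N; move: n0.
  move: (complex.Re _) (complex.Re _) (complex.Im _) (complex.Im _) => y x a b n0.
  by field.
under eq_fun do rewrite ImV.
apply: (is_derive_eq (is_deriveM (is_deriveN c2) dV)).
rewrite (nE _).1 !(ReM, ImM) ReV ImV fctE /GRing.scale /= /N; move: n0.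
move: (complex.Re _) (complex.Re _) (complex.Im _) (complex.Im _) => y x a b n0.
by field.
Qed.

Lemma curve_derive_horner (P : {poly C}) c t d : curve_derive c t d ->
  curve_derive (fun s => P.[c s]) t (P^`().[c t] * d).
Proof.
move=> dc; elim/poly_ind: P => [|P a ih].
  rewrite deriv0 horner0 mul0r.
  by apply: curve_derive_ext (curve_derive_cst 0 t) => s; rewrite horner0.
have := curve_deriveD (curve_deriveM ih dc) (curve_derive_cst a t).
move=> /curve_derive_eq h; apply: curve_derive_ext (h _ _).
  by move=> s; rewrite hornerMXaddC.
by rewrite derivMXaddC hornerD hornerMX /=; ring.
Qed.

Lemma curve_derive_ratio (P Q : {poly C}) c t d : Q.[c t] != 0 ->
  curve_derive c t d ->
  curve_derive (fun s => P.[c s] / Q.[c s]) t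
    ((P^`() * Q - P * Q^`()).[c t] / (Q * Q).[c t] * d).
Proof.
move=> Qt dc.
apply: curve_derive_eq.
  apply: curve_deriveM (curve_derive_horner P dc) _.
  exact: curve_deriveV Qt (curve_derive_horner Q dc).
by rewrite !hornerE; field.
Qed.
End ComplexCurves.

(** * Vanishing of integrals over the imaginary axis *)

Section ImaginaryAxis.
Import numFieldNormedType.Exports.
Local Open Scope classical_set_scope.
Variable K : realType.
Local Notation C := K[i].
Local Notation mu := (@lebesgue_measure K).
Implicit Types (P Q : {poly C}) (z x : C) (M t w : K).

Lemma decay_real_bound z x M : `|x| * (1 + `|z|) ^+ 2 <= M%:C ->
  forall a b : K, a = complex.Re x \/ a = complex.Im x ->
   b = complex.Re z \/ b = complex.Im z -> `|a| <= M * (oneDsqr b)^-1.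
Proof.
move=> h a b ha hb; rewrite ler_pdivlMr ?oneDsqr_gt0 // -lecR; apply: le_trans h.
rewrite rmorphM; apply: ler_pM; rewrite ?ler0c ?(ltW (oneDsqr_gt0 _)) //.
  by case: ha => ->; [exact: normc_ge_Re|exact: normc_ge_Im].
have hb' : (b ^+ 2)%:C <= `|z| ^+ 2.
  rewrite -add_Re2_Im2 lecR; case: hb => ->; rewrite ?lerDl ?lerDr ?sqr_ge0 //.
rewrite /oneDsqr rmorphD /= sqrrD expr1n mul1r -addrA.
apply: lerD => //.
by apply: le_trans hb' _; rewrite lerDr mulrn_wge0.
Qed.

Lemma stable_ratio_decay P Q : stable_poly Q -> ((size P).-1 + 2 < size Q)%N ->
  exists2 delta : K, 0 < delta & exists2 M : K, 0 <= M &
    forall t w, - delta <= t -> let x := P.[t +i* w] / Q.[t +i* w] in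
      [/\ Q.[t +i* w] != 0, `|complex.Re x| <= M * (oneDsqr w)^-1,
          `|complex.Im x| <= M * (oneDsqr w)^-1 &
          `|complex.Re x| <= M * (oneDsqr t)^-1].
Proof.
move=> hQ s; have [delta d0 [M M0 h]] := stable_ratio_bound hQ s.
exists delta => //; exists M => // t w tw x.
have [Q0 hx] := h (t +i* w) tw.
by split=> //; apply: (decay_real_bound hx); auto.
Qed.

(** Cauchy's theorem for the right half-plane, without contour integrals. The
    integral F(t) over the line Re s = t does not depend on t: differentiating
    in t under the integral sign gives the integral of the derivative along that
    line, which is 0 since the derivative is integrable with a primitive that
    vanishes at both ends. And F(t) tends to 0 as t grows, by dominated
    convergence. *)
Theorem Rintegral_imaginary_axis P Q : stable_poly Q ->
  ((size P).-1 + 2 < size Q)%N ->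
  \int[mu]_(w in setT) complex.Re (P.[0 +i* w] / Q.[0 +i* w]) = 0.
Proof.
move=> hQ s; pose P' := P^`() * Q - P * Q^`().
have Q0 := stable_poly_neq0 hQ.
have s' : ((size P').-1 + 2 < size (Q * Q)%R)%N.
  have hd (p q : {poly C}) : (size (deriv p * q)%R <= (size p + size q).-1)%N.
    apply: leq_trans (size_polyMleq _ _) _.
    have : (size (deriv p) <= size p)%N by exact: leq_trans (size_poly _ _) (leq_pred _).
    lia.
  have h1 := hd P Q; have h2 := hd Q P; rewrite mulrC in h2.
  have := size_polyD (P^`() * Q) (- (P * Q^`())); rewrite size_polyN (size_mul Q0 Q0).
  move: s h1 h2; rewrite /P'; move: (size (_ - _ : {poly C})).
  move: (size (P * _ : {poly C})) (size (_ * Q : {poly C})).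
  move: (size P) (size Q); lia.
have [d1 d10 [M1 M10 h1]] := stable_ratio_decay hQ s.
have [d2 d20 [M2 M20 h2]] := stable_ratio_decay (stable_polyM hQ hQ) s'.
pose delta := Num.min d1 d2.
have d0 : 0 < delta by rewrite lt_min d10.
pose x t w := P.[t +i* w] / Q.[t +i* w].
pose x' t w := P'.[t +i* w] / (Q * Q).[t +i* w].
pose u t w := complex.Re (x t w).
pose u' t w := complex.Re (x' t w).
have u_bound t w : - delta <= t -> [/\ Q.[t +i* w] != 0,
    `|u t w| <= M1 * (oneDsqr w)^-1,
    `|complex.Im (x t w)| <= M1 * (oneDsqr w)^-1 &
    `|u t w| <= M1 * (oneDsqr t)^-1].
  move=> ht; apply: h1; apply: le_trans ht; rewrite lerN2 ge_min lexx //.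
have u'_bound t w : - delta <= t -> (Q * Q).[t +i* w] != 0 /\ `|u' t w| <= M2 * (oneDsqr w)^-1.
  move=> ht; have [] // := h2 t w.
  by apply: le_trans ht; rewrite lerN2 ge_min lexx orbT.
have dt t w : - delta <= t -> is_derive t (1 : K) (u ^~ w) (u' t w).
  move=> /(u_bound _ w) [Qz _ _ _].
  have [] := curve_derive_ratio P Qz (curve_derive_horizontal w t).
  by rewrite mulr1.
have dw t w : - delta <= t -> is_derive w (1 : K) (fun w => complex.Im (x t w)) (u' t w).
  move=> /(u_bound _ w) [Qz _ _ _].
  have [_] := curve_derive_ratio P Qz (curve_derive_vertical t w).
  by rewrite -mulrC ImM /= mul0r add0r mul1r.
have cu' t : - delta <= t -> continuous (u' t).
  move=> ht w.
  have [+ _] := curve_derive_ratio P' (u'_bound t w ht).1 (curve_derive_vertical t w).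
  by move=> h; apply/differentiable_continuous/derivable1_diffP; case: h.
have cu t : - delta <= t -> continuous (u t).
  move=> ht w; have [Qz _ _ _] := u_bound t w ht.
  have [+ _] := curve_derive_ratio P Qz (curve_derive_vertical t w).
  by move=> h; apply/differentiable_continuous/derivable1_diffP; case: h.
pose F t := \int[mu]_(w in setT) u t w.
have F0 t : - delta < t -> is_derive t (1 : K) F 0.
  move=> ht.
  have I r : `]- delta, t + 1[%classic r -> - delta <= r.
    by rewrite /= in_itv /= => /andP[/ltW].
  have It : `]- delta, t + 1[%classic t by rewrite /= in_itv /= ht ltrDl ltr01.
  have d1u r w : `]- delta, t + 1[%classic r -> (partial1of2 u) r w = u' r w.
    by move=> /I hr; rewrite partial1of2E; have := dt r w hr => ?; rewrite derive_val.
  have A1 r : `]- delta, t + 1[%classic r -> mu.-integrable setT (EFin \o u r).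
    move=> /I hr; apply: (@integrable_dominated _ M1); first exact: cu.
    by move=> w; have [] := u_bound r w hr.
  have A2 r w : `]- delta, t + 1[%classic r -> setT w -> derivable (u ^~ w) r 1.
    by move=> /I hr _; have := dt r w hr => ?; exact: ex_derive.
  have A3 w : 0 <= M2 * (oneDsqr w)^-1 by rewrite mulr_ge0 // invr_ge0 ltW // oneDsqr_gt0.
  have A4 : mu.-integrable setT (EFin \o (fun w => M2 * (oneDsqr w)^-1)).
    exact: (integrableZl _ M2 (integrable_oneDsqrV K)).
  have A5 r w : `]- delta, t + 1[%classic r -> setT w ->
      `|partial1of2 u r w| <= M2 * (oneDsqr w)^-1.
    by move=> hr _; rewrite d1u //; have [] := u'_bound r w (I r hr).
  apply: DeriveDef.
    exact: (derivable_under_integral measurableT It A1 A2 A3 A4 A5).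
  rewrite -derive1E (differentiation_under_integral measurableT It A1 A2 A3 A4 A5).
  transitivity (\int[mu]_(w in setT) u' t w).
    by apply: eq_Rintegral => w _; rewrite d1u.
  apply: (@Rintegral_derivative _ (M1 + M2) _ (fun w => complex.Im (x t w))).
  - by move=> w; apply: dw; exact: I.
  - by apply: cu'; exact: I.
  - move=> w; have [_ h] := u'_bound t w (I t It); apply: le_trans h _.
    by rewrite ler_wpM2r ?lerDr // invr_ge0 ltW // oneDsqr_gt0.
  - move=> w; have [_ _ h _] := u_bound t w (I t It); apply: le_trans h _.
    by rewrite ler_wpM2r ?lerDl // invr_ge0 ltW // oneDsqr_gt0.
have Fn (n : nat) : F n%:R = F 0.
  apply/eqP; rewrite -subr_eq0; apply/eqP.
  have [||c _ ->] := @MVT_segment _ F (fun=> 0) 0 n%:R (ler0n _ _).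
  - move=> r; rewrite in_itv /= => /andP[r0 _]; apply: F0; apply: lt_trans r0.
    by rewrite oppr_lt0.
  - apply: derivable_within_continuous => r; rewrite in_itv /= => /andP[r0 _].
    have /F0 h : - delta < r by apply: lt_le_trans r0; rewrite oppr_lt0.
    exact: ex_derive.
  - by rewrite mul0r.
have c1 : F n%:R @[n --> \oo] --> \int[mu]_(w in setT) (0 : K).
  have dn n : - delta <= n%:R by apply: le_trans (ler0n _ _); rewrite oppr_le0 ltW.
  apply: (@Rintegral_dominated_cvg _ (fun n => u n%:R) (fun=> 0)
    (fun w => M1 * (oneDsqr w)^-1)) => //.
  - by move=> n; apply: continuous_measurable_fun; exact: cu.
  - exact: (integrableZl _ M1 (integrable_oneDsqrV K)).
  - move=> w; apply: (@cvg_dominated _ M1 (fun n => n%:R)) => n.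
      by have [] := u_bound _ w (dn n).
    by rewrite ger0_norm.
  - by move=> n w; have [] := u_bound _ w (dn n).
have c2 : F n%:R @[n --> \oo] --> F 0.
  by under eq_fun do rewrite Fn; exact: cvg_cst.
rewrite -[LHS]/(F 0) -(cvg_unique _ c1 c2) //.
by rewrite Rintegral_cst // mul0r.
Qed.
End ImaginaryAxis.

(** * Stable rational matrices and the Hardy space *)

Section NumFieldRational.
Import numFieldNormedType.Exports.
Local Open Scope classical_set_scope.
Variable R : numFieldType.
Implicit Types (P Q : {poly R}) (z : R).

Lemma derivable_numField_horner P z : derivable (horner P : R -> R) z 1.
Proof.
elim/poly_ind: P => [|P a ih].
  rewrite (_ : horner 0 = cst 0); [exact: derivable_cst|].
  by apply/funext => x; rewrite horner0.
rewrite (_ : horner _ = (fun x : R => P.[x]) * id + cst a).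
  apply: derivableD; last exact: derivable_cst.
  by apply: derivableM; [exact: ih|exact: derivable_id].
by apply/funext => x; rewrite hornerMXaddC.
Qed.

Lemma horner_near_neq0 P z : P.[z] != 0 -> \forall w \near z, P.[w] != 0.
Proof.
move=> Pz; have := @derivable_numField_horner P z.
move=> /derivable1_diffP/differentiable_continuous c.
exact: (cvgr_neq0 _ c).
Qed.

Lemma near_derivable_ratio P Q z : Q.[z] != 0 ->
  \forall w \near z, derivable (fun x : R => P.[x] / Q.[x]) w 1.
Proof.
move=> /horner_near_neq0; apply: filterS => w dw.
apply: (derivableM (f := horner P) (g := fun x => Q.[x]^-1)).
  exact: derivable_numField_horner.
by apply: (derivableV (f := horner Q)) => //; exact: derivable_numField_horner.
Qed.

End NumFieldRational.

Section HardySpace.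
Import numFieldNormedType.Exports.
Local Open Scope classical_set_scope.
Variable K : realType.
Local Notation C := K[i].
Local Notation mu := (@lebesgue_measure K).
Implicit Types (f g : ratfun K).

Lemma ratfun_eval_analytic f z : (ratfun_den f).[z] != 0 -> analytic_at (ratfun_eval f) z.
Proof. exact: near_derivable_ratio. Qed.

Lemma stable_ratfun_ratio d f : stable_ratfun d f -> exists P Q : {poly C},
  [/\ stable_poly Q, ((size P).-1 + d < size Q)%N &
      forall z, 0 <= complex.Re z -> ratfun_eval f z = P.[z] / Q.[z]].
Proof.
move=> [P [Q [hQ s ->]]]; exists P, Q; split=> // z z0.
by apply: has_value_eval; exists P, Q; split=> //; exact: stable_poly_horner.
Qed.

Lemma stable_ratfun_continuous d f : stable_ratfun d f ->
  continuous (fun w : K => complex.Re (ratfun_eval f (0 +i* w))) /\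
  continuous (fun w : K => complex.Im (ratfun_eval f (0 +i* w))).
Proof.
move=> /stable_ratfun_ratio [P [Q [hQ _ e]]].
have Q0 w : Q.[0 +i* w] != 0 by apply: stable_poly_horner.
have h w := curve_derive_ratio P (Q0 w) (curve_derive_vertical 0 w).
split=> w; apply/differentiable_continuous/derivable1_diffP.
  under eq_fun do rewrite e //.
  by have [[]] := h w.
under eq_fun do rewrite e //.
by have [_ []] := h w.
Qed.

Lemma stable_ratfun_decay f : stable_ratfun 1 f -> exists2 M : K, 0 <= M &
  forall z, 0 <= complex.Re z -> `|ratfun_eval f z| * (1 + `|z|) <= M%:C.
Proof.
move=> /stable_ratfun_ratio [P [Q [hQ s e]]].
have [delta d0 [M M0 h]] := stable_ratio_bound hQ s.
exists M => // z z0; rewrite e //.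
by have [|_] := h z; rewrite ?expr1 // (le_trans _ z0) // oppr_le0 ltW.
Qed.

(** Each factor decays like 1/s, so the product is dominated by an inverse
    square. *)
Lemma stable_ratfun_pairing_integrable f g :
  stable_ratfun 1 f -> stable_ratfun 1 g ->
  mu.-integrable setT (EFin \o (fun w : K =>
    complex.Re (ratfun_eval f (0 +i* w) * Num.conj (ratfun_eval g (0 +i* w))))).
Proof.
move=> hf hg; have [M M0 hM] := stable_ratfun_decay hf.
have [N N0 hN] := stable_ratfun_decay hg.
have [f1 f2] := stable_ratfun_continuous hf.
have [g1 g2] := stable_ratfun_continuous hg.
apply: (@integrable_dominated _ (M * N)).
  under eq_fun do rewrite ReMconj.
  by move=> w; apply: cvgD; apply: cvgM; [exact: f1|exact: g1|exact: f2|exact: g2].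
move=> w; set z := 0 +i* w.
apply: (@decay_real_bound _ z (ratfun_eval f z * Num.conj (ratfun_eval g z))); auto.
rewrite normrM norm_conjC expr2 mulrACA rmorphM.
by apply: ler_pM; rewrite ?mulr_ge0 ?addr_ge0 ?hM ?hN.
Qed.

Lemma Rintegral_stable_ratfun f : stable_ratfun 2 f ->
  \int[mu]_(w in setT) complex.Re (ratfun_eval f (0 +i* w)) = 0.
Proof.
move=> /stable_ratfun_ratio [P [Q [hQ s e]]].
by rewrite -[RHS](Rintegral_imaginary_axis hQ s); apply: eq_Rintegral => w _; rewrite e.
Qed.

Section Matrices.
Variables p m : nat.
Implicit Types F H : 'M[ratfun K]_(p, m).

Definition stable_mx F := forall i j, stable_ratfun 1 (F i j).

Lemma h2_integrandE F H w : h2_integrand F H w =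
  \sum_i \sum_j ratfun_eval (F i j) (0 +i* w) * Num.conj (ratfun_eval (H i j) (0 +i* w)).
Proof.
rewrite /h2_integrand /mxtrace; apply: eq_bigr => i _; rewrite mxE.
by apply: eq_bigr => j _; rewrite !mxE.
Qed.

Lemma h2_integrand_integrable F H : stable_mx F -> stable_mx H ->
  mu.-integrable setT (fun w => (complex.Re (h2_integrand F H w))%:E).
Proof.
move=> hF hH; under eq_fun do rewrite h2_integrandE Re_sum -sumEFin.
apply: integrable_sum => // i _.
under eq_fun do rewrite Re_sum -sumEFin.
apply: integrable_sum => // j _.
exact: stable_ratfun_pairing_integrable.
Qed.

Lemma stable_mx_H2 F : stable_mx F -> H2 F.
Proof.
move=> hF; split; last exact: h2_integrand_integrable.
move=> i j z z0.
have /has_value_den := stable_ratfun_value (hF i j) z0.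
rewrite (_ : (fun s => _) = ratfun_eval (F i j)); first exact: ratfun_eval_analytic.
by apply/funext => s; rewrite mxE.
Qed.

End Matrices.
End HardySpace.

(** * Orthogonality and definiteness of the norm *)

Section HilbertGeometry.
Import numFieldNormedType.Exports.
Local Open Scope classical_set_scope.
Variable K : realType.
Local Notation C := K[i].
Local Notation mu := (@lebesgue_measure K).

(** A continuous function that is nonzero at a point is nonzero on a ball, and
    balls are not negligible. *)
Lemma Rintegral_continuous_eq0 (h : K -> K) : continuous h -> (forall w, 0 <= h w) ->
  mu.-integrable setT (EFin \o h) -> \int[mu]_(w in setT) h w = 0 -> forall w, h w = 0.
Proof.
move=> ch h0 ih I0 w; apply/eqP/negPn/negP => hw.
have mh : measurable_fun setT (EFin \o h) 
  by apply/measurable_EFinP; exact: continuous_measurable_fun.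
have /(ae_eq_integral_abs mu measurableT mh) [N [mN N0 sN]] :
    (\int[mu]_(x in setT) `|(EFin \o h) x| = 0)%E.
  under eq_integral do rewrite /= ger0_norm //.
  rewrite -(fineK (integrable_fin_num measurableT ih)); congr EFin; exact: I0.
have /nbhs_ballP [e /= e0 he] : \forall x \near w, h x != 0 by exact: (cvgr_neq0 _ (ch w)).
have : (mu (ball w e) <= mu N)%E.
  apply: le_measure; rewrite ?inE //; first exact: measurable_ball.
  move=> x /he hx; apply: sN => /= /(_ I) [].
  by move/eqP: hx.
rewrite N0 lebesgue_measure_ball; last exact: ltW.
by apply/negP; rewrite -ltNge lte_fin mulrn_wgt0.
Qed.

(** A nonzero numerator has finitely many roots. *)
Lemma ratfun_eq0 (f : ratfun K) : stable_ratfun 1 f ->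
  (forall w, ratfun_eval f (0 +i* w) = 0) -> f = 0.
Proof.
move=> [P [Q [hQ _ fE]]] h.
suff P0 : P = 0 by rewrite fE P0 tofrac0 mul0r.
have Pw w : P.[0 +i* w] = 0.
  have Qw := stable_poly_horner (z := 0 +i* w) hQ (lexx 0).
  have hv : has_value f (0 +i* w) (P.[0 +i* w] / Q.[0 +i* w]) by exists P, Q.
  have := h w; rewrite (has_value_eval hv) => /eqP.
  by rewrite mulf_eq0 invr_eq0 (negPf Qw) orbF => /eqP.
apply/eqP/negPn/negP => P0.
have := max_poly_roots P0 (rs := [seq 0 +i* (n%:R : K) | n <- iota 0 (size P)]).
rewrite size_map size_iota ltnn => H; apply: notF; apply: H.
  by apply/allP => _ /mapP[n _ ->]; apply/eqP.
rewrite map_inj_uniq ?iota_uniq // => a b [] /eqP.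
by rewrite eqr_nat => /eqP.
Qed.

Variables p m : nat.
Implicit Types F H : 'M[ratfun K]_(p, m).

(** Twice pi times the real part of [h2_inner], the only part that enters the
    norm and the theorem of Pythagoras. *)
Definition h2_real_inner F H : K :=
  \int[mu]_(w in setT) complex.Re (h2_integrand F H w).

Lemma h2_normE F : h2_norm F = Num.sqrt ((2 * pi)^-1 * h2_real_inner F F).
Proof. by rewrite /h2_norm /h2_inner ReM /= mul0r subr0. Qed.

Lemma h2_integrand_ge0 F w : 0 <= complex.Re (h2_integrand F F w).
Proof.
rewrite h2_integrandE Re_sum sumr_ge0 // => i _; rewrite Re_sum sumr_ge0 // => j _.
exact: Re_mulconj_ge0.
Qed.

Lemma h2_real_inner_ge0 F : 0 <= h2_real_inner F F.
Proof. by apply: Rintegral_ge0 => w _; exact: h2_integrand_ge0. Qed.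

Lemma le_h2_norm F H : (h2_norm F <= h2_norm H) = (h2_real_inner F F <= h2_real_inner H H).
Proof.
have pi0 : 0 < (2 * pi)^-1 :> K by rewrite invr_gt0 mulr_gt0 // pi_gt0.
rewrite !h2_normE ler_sqrt; last by rewrite mulr_ge0 ?h2_real_inner_ge0 // ltW.
by rewrite ler_pM2l.
Qed.

Lemma stable_mxD F H : stable_mx F -> stable_mx H -> stable_mx (F + H).
Proof. by move=> hF hH i j; rewrite mxE; exact: stable_ratfunD. Qed.

Lemma stable_mxN F : stable_mx F -> stable_mx (- F).
Proof. by move=> hF i j; rewrite mxE; exact: stable_ratfunN. Qed.

Lemma stable_mxB F H : stable_mx F -> stable_mx H -> stable_mx (F - H).
Proof. by move=> hF hH; apply/stable_mxD/stable_mxN. Qed.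

Lemma h2_real_inner_pythagoras F H : stable_mx F -> stable_mx H ->
  h2_real_inner F H = 0 ->
  h2_real_inner (F + H) (F + H) = h2_real_inner F F + h2_real_inner H H.
Proof.
move=> hF hH FH0.
have iFF := h2_integrand_integrable hF hF.
have iFH := h2_integrand_integrable hF hH.
have iHH := h2_integrand_integrable hH hH.
transitivity (\int[mu]_(w in setT) ((complex.Re (h2_integrand F F w) +
    complex.Re (h2_integrand H H w)) + 2 * complex.Re (h2_integrand F H w))).
  apply: eq_Rintegral => w _; rewrite !h2_integrandE !Re_sum mulr_sumr -!big_split.
  apply: eq_bigr => i _; rewrite /= !Re_sum mulr_sumr -!big_split.
  apply: eq_bigr => j _; rewrite /= mxE.
  have vF := stable_ratfun_value (z := 0 +i* w) (hF i j) (lexx 0).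
  have vH := stable_ratfun_value (z := 0 +i* w) (hH i j) (lexx 0).
  rewrite (has_value_eval (has_valueD vF vH)) !ReMconj ReD ImD; ring.
rewrite !RintegralD //; last 2 first.
- exact: (integrableD measurableT iFF iHH).
- exact: (integrableZl measurableT 2 iFH).
by rewrite RintegralZl // -[X in 2 * X]/(h2_real_inner F H) FH0 mulr0 addr0.
Qed.

Lemma h2_real_inner_definite F : stable_mx F -> h2_real_inner F F = 0 -> F = 0.
Proof.
move=> hF F0; apply/matrixP => i j; rewrite mxE; apply: ratfun_eq0 => // w.
pose x w := ratfun_eval (F i j) (0 +i* w).
have ix := stable_ratfun_pairing_integrable (hF i j) (hF i j).
suff : complex.Re (x w * Num.conj (x w)) = 0.
  rewrite ReMconj -!expr2 => /eqP; rewrite paddr_eq0 ?sqr_ge0 // !sqrf_eq0 /x.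
  by case: (ratfun_eval _ _) => a b /= /andP[/eqP -> /eqP ->].
move: w; apply: Rintegral_continuous_eq0 => [|w||].
- under eq_fun do rewrite ReMconj.
  have [f1 f2] := stable_ratfun_continuous (hF i j).
  by move=> w; apply: cvgD; apply: cvgM; [exact: f1|exact: f1|exact: f2|exact: f2].
- exact: Re_mulconj_ge0.
- exact: ix.
apply/eqP; rewrite eq_le Rintegral_ge0 ?andbT; last by move=> w _; exact: Re_mulconj_ge0.
rewrite -F0; apply: le_Rintegral => //; first exact: h2_integrand_integrable.
move=> w _; rewrite h2_integrandE Re_sum (bigD1 i) //= Re_sum (bigD1 j) //= -addrA lerDl.
rewrite addr_ge0 ?sumr_ge0 // => k _; first exact: Re_mulconj_ge0.
by rewrite Re_sum sumr_ge0 // => l _; exact: Re_mulconj_ge0.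
Qed.

End HilbertGeometry.

(** * Transfer functions of descriptor systems *)

Section Adjoint.
Variable C : numClosedFieldType.

Lemma adjmxM m n p (A : 'M[C]_(m, n)) (B : 'M[C]_(n, p)) :
  (A *m B)^t* = B^t* *m A^t*.
Proof. by rewrite trmx_mul map_mxM. Qed.

Lemma adjmx_invmx n (A : 'M[C]_n) : (invmx A)^t* = invmx (A^t*).
Proof. by rewrite trmx_inv map_invmx. Qed.

Lemma adjmx_unit n (A : 'M[C]_n) : (A^t* \in unitmx) = (A \in unitmx).
Proof. by rewrite map_unitmx unitmx_tr. Qed.

End Adjoint.

Lemma invmx_eq (R : comUnitRingType) n (A B : 'M[R]_n) : A *m B = 1%:M -> invmx A = B.
Proof.
move=> AB; have [uA _] := mulmx1_unit AB.
by rewrite -[RHS](mulKmx uA) AB mulmx1.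
Qed.

Lemma invmx_mul (R : comUnitRingType) n (A B : 'M[R]_n) :
  A \in unitmx -> B \in unitmx -> invmx (A *m B) = invmx B *m invmx A.
Proof.
move=> uA uB; apply: invmx_eq.
by rewrite mulmxA -(mulmxA A) (mulmxV uB) mulmx1 mulmxV.
Qed.

Lemma resolvent_equiv (R : comUnitRingType) n (a : R) (P E A Q : 'M[R]_n) :
  P \in unitmx -> Q \in unitmx -> a *: E - A \in unitmx ->
  invmx (a *: (P *m E *m Q) - P *m A *m Q) = invmx Q *m invmx (a *: E - A) *m invmx P.
Proof.
move=> uP uQ u; rewrite scalemxAl scalemxAr -mulmxBl -mulmxBr.
by rewrite (invmx_mul _ uQ) ?unitmx_mul ?uP // (invmx_mul uP u) mulmxA.
Qed.

Section TransferFunctions.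
Variable K : realType.
Local Notation C := K[i].
Local Notation "p %:F" := (FracField.tofrac p).
Local Notation cst := (map_mx (@ratfun_cst K)).

Definition pencil n (E A : 'M[C]_n) : 'M[{poly C}]_n :=
  'X *: map_mx polyC E - map_mx polyC A.

Lemma map_cstE m n (M : 'M[C]_(m, n)) :
  cst M = map_mx (@FracField.tofrac _) (map_mx polyC M).
Proof. by apply/matrixP => i j; rewrite !mxE. Qed.

Lemma map_cstM m n p (M : 'M[C]_(m, n)) (N : 'M[C]_(n, p)) :
  cst (M *m N) = cst M *m cst N.
Proof. by rewrite !map_cstE !map_mxM. Qed.

Lemma ratfun_pencilE n (E A : 'M[C]_n) :
  ratfun_var K *: cst E - cst A = map_mx (@FracField.tofrac _) (pencil E A).
Proof. by rewrite !map_cstE map_mxB map_mxZ. Qed.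

Lemma ratfun_pencil_unit n (E A : 'M[C]_n) : \det (pencil E A) != 0 ->
  ratfun_var K *: cst E - cst A \in unitmx.
Proof.
by move=> h; rewrite ratfun_pencilE unitmxE det_map_mx unitfE tofrac_eq0.
Qed.

Lemma transferE n m p (E A : 'M[C]_n) (B : 'M[C]_(n, m)) (D : 'M[C]_(p, n)) i j :
  \det (pencil E A) != 0 ->
  transfer E A B D i j =
    ((map_mx polyC D *m \adj (pencil E A) *m map_mx polyC B) i j)%:F /
    (\det (pencil E A))%:F.
Proof.
move=> h; rewrite /transfer /invmx ratfun_pencil_unit // ratfun_pencilE !map_cstE.
rewrite det_map_mx -map_mx_adj -scalemxAr -scalemxAl -!map_mxM !mxE mulrC.
by [].
Qed.

Lemma horner_pencil n (E A : 'M[C]_n) (z : C) :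
  map_mx (horner_eval z) (pencil E A) = z *: E - A.
Proof. by apply/matrixP => i j; rewrite !mxE horner_evalE !hornerE. Qed.

Lemma det_pencil_horner n (E A : 'M[C]_n) (z : C) :
  (\det (pencil E A)).[z] = \det (z *: E - A).
Proof. by rewrite -horner_evalE -det_map_mx horner_pencil. Qed.

Lemma transfer_has_value n m p (E A : 'M[C]_n) (B : 'M[C]_(n, m)) (D : 'M[C]_(p, n))
    (z : C) i j : z *: E - A \in unitmx ->
  has_value (transfer E A B D i j) z ((D *m invmx (z *: E - A) *m B) i j).
Proof.
move=> u; have d0 : (\det (pencil E A)).[z] != 0.
  by rewrite det_pencil_horner -unitfE -unitmxE.
rewrite transferE ?(horner_neq0 d0) //.
exists ((map_mx polyC D *m \adj (pencil E A) *m map_mx polyC B) i j), (\det (pencil E A)).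
split=> //; rewrite /invmx u -scalemxAr -scalemxAl mxE mulrC det_pencil_horner; congr (_ * _).
have pK k l (M : 'M[C]_(k, l)) : map_mx (horner_eval z) (map_mx polyC M) = M.
  by apply/matrixP => a b; rewrite !mxE horner_evalE hornerC.
rewrite -horner_evalE -[in LHS](pK _ _ D) -[in LHS](pK _ _ B) -horner_pencil -map_mx_adj.
by rewrite -!map_mxM mxE.
Qed.

(** A column [v] of a solution of a Sylvester equation encodes the value of the
    transfer function at [z] in the direction [r]: v = - (z E - A)^-1 B r. *)
Lemma transfer_tangential n m p (E A : 'M[C]_n) (B : 'M[C]_(n, m)) (D : 'M[C]_(p, n))
    (z : C) (v : 'cV[C]_n) (r : 'cV[C]_m) i : z *: E - A \in unitmx ->
  A *m v - z *: (E *m v) = B *m r ->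
  \sum_j ratfun_eval (transfer E A B D i j) z * r j 0 = - (D *m v) i 0.
Proof.
move=> u h; under eq_bigr do rewrite (has_value_eval (transfer_has_value B D _ _ u)).
transitivity ((D *m invmx (z *: E - A) *m B *m r) i 0); first by rewrite [RHS]mxE.
have {}h : B *m r = - ((z *: E - A) *m v) by rewrite mulmxBl -scalemxAl opprB h.
rewrite -mulmxA h mulmxN.
by rewrite -mulmxA (mulmxA (invmx _)) mulVmx // mul1mx mxE.
Qed.

(** The roots of the determinant are the finite generalized eigenvalues. *)
Lemma stable_poly_det_pencil n (E A : 'M[C]_n) : asymptotically_stable E A ->
  stable_poly (\det (pencil E A)).
Proof.
move=> h z; rewrite /root det_pencil_horner -det_tr => /det0P[v v0 e].
apply: h; exists v^T; first by rewrite trmx_eq0.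
move: e => /(congr1 trmx); rewrite trmx_mul trmxK trmx0 mulmxBl -scalemxAl => /eqP.
by rewrite subr_eq0 => /eqP <-.
Qed.

(** Strict properness cannot be read off a realization with singular E, so the
    degree bound comes from the behaviour at infinity and only the location of
    the poles comes from the pencil. *)
Lemma transfer_stable n m p (E A : 'M[C]_n) (B : 'M[C]_(n, m)) (D : 'M[C]_(p, n)) :
  regular_pencil E A -> asymptotically_stable E A ->
  strictly_proper (transfer E A B D) -> stable_mx (transfer E A B D).
Proof.
move=> reg st sp i j; apply: strictly_proper_stable.
  move=> eps e0; have [M hM] := sp i j eps e0; exists M => z /hM.
  by rewrite mxE.
move=> z hz; apply: (stable_poly_det_pencil st); rewrite transferE // in hz.
have /dvdpP [c ->] := ratfun_den_dvd
  ((map_mx polyC D *m \adj (pencil E A) *m map_mx polyC B) i j) reg.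
by rewrite rootM hz orbT.
Qed.

Lemma transfer_equiv n m p (P E A Q : 'M[C]_n) (B : 'M[C]_(n, m)) (D : 'M[C]_(p, n)) :
  P \in unitmx -> Q \in unitmx -> \det (pencil E A) != 0 ->
  transfer (P *m E *m Q) (P *m A *m Q) B D = transfer E A (invmx P *m B) (D *m invmx Q).
Proof.
move=> uP uQ /ratfun_pencil_unit u; rewrite /transfer.
have cU (M : 'M[C]_n) : M \in unitmx -> cst M \in unitmx /\ cst (invmx M) = invmx (cst M).
  move=> uM; have h : cst M *m cst (invmx M) = 1%:M.
    by rewrite -map_cstM mulmxV // map_cstE !map_mx1.
  split; first exact: (mulmx1_unit h).1.
  exact: (esym (invmx_eq h)).
have [uP' eP] := cU P uP; have [uQ' eQ] := cU Q uQ.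
rewrite !map_cstM eP eQ.
by rewrite (resolvent_equiv uP' uQ' u) !mulmxA.
Qed.

Lemma det_pencil1 n (A : 'M[C]_n) : \det (pencil 1%:M A) != 0.
Proof.
rewrite (_ : pencil _ _ = char_poly_mx A) ?monic_neq0 ?char_poly_monic //.
by rewrite /pencil map_mx1 /char_poly_mx scalemx1.
Qed.

Lemma transfer_diag n m p (d : 'rV[C]_n) (B : 'M[C]_(n, m)) (D : 'M[C]_(p, n)) i j :
  transfer 1%:M (diag_mx d) B D i j =
    \sum_k ratfun_cst (D i k * B k j) * (('X - (d 0 k)%:P)%:F)^-1.
Proof.
rewrite /transfer.
rewrite (@invmx_eq _ _ _ (diag_mx (\row_k (('X - (d 0 k)%:P)%:F)^-1))).
  rewrite mul_mx_diag mxE; apply: eq_bigr => k _; rewrite !mxE.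
  by rewrite /ratfun_cst polyCM tofracM mulrAC.
apply/matrixP => a b; rewrite mul_mx_diag !mxE.
case: (eqVneq a b) => [->|ab].
  rewrite /ratfun_cst /ratfun_var mulr1n tofrac1 mulr1 -tofracB mulfV //.
  by rewrite tofrac_eq0 polyXsubC_eq0.
by rewrite /= !mulr0n /ratfun_cst tofrac0 mulr0 subr0 mul0r.
Qed.

Lemma transferB n m p (E A : 'M[C]_n) (B : 'M[C]_(n, m)) (D D' : 'M[C]_(p, n)) :
  transfer E A B (D - D') = transfer E A B D - transfer E A B D'.
Proof. by rewrite /transfer !map_cstE !map_mxB !mulmxBl. Qed.

Lemma transferN n m p (E A : 'M[C]_n) (B : 'M[C]_(n, m)) (D : 'M[C]_(p, n)) :
  transfer E A (- B) D = transfer E A B (- D).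
Proof. by rewrite /transfer !map_cstE !map_mxN mulmxN !mulNmx. Qed.

End TransferFunctions.

(** * Transfer functions with prescribed poles *)

Section PoleResidueFamily.
Variables (K : realType) (p m q : nat).
Local Notation C := K[i].
Local Notation mu := (@lebesgue_measure K).
Variables (sigma : 'rV[C]_q) (R : 'M[C]_(m, q)).
Hypothesis sigma_gt0 : forall k, 0 < complex.Re (sigma 0 k).
Implicit Types (L : 'M[C]_(p, q)) (F : 'M[ratfun K]_(p, m)).

(** The competitors in eigenvector coordinates; [L] collects the left residue
    directions. *)
Definition residue_mx L : 'M[ratfun K]_(p, m) :=
  transfer 1%:M (- (diag_mx sigma)^t*) (R^t*) L.

Lemma adjmx_diag (d : 'rV[C]_q) : - (diag_mx d)^t* = diag_mx (- map_mx Num.conj d).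
Proof. by rewrite tr_diag_mx map_diag_mx raddfN. Qed.

Lemma residue_mxE L i j : residue_mx L i j =
  \sum_k ratfun_cst (L i k * Num.conj (R j k)) *
    (FracField.tofrac ('X - (- Num.conj (sigma 0 k))%:P))^-1.
Proof.
rewrite /residue_mx adjmx_diag transfer_diag; apply: eq_bigr => k _.
by rewrite !mxE.
Qed.

Lemma Re_pole k : complex.Re (- Num.conj (sigma 0 k)) < 0.
Proof. by move: (sigma_gt0 k); case: (sigma 0 k) => a b /=; rewrite oppr_lt0. Qed.

Lemma residue_mx_stable L : stable_mx (residue_mx L).
Proof.
move=> i j; rewrite residue_mxE; apply: stable_ratfun_sum => k.
by apply/stable_ratfun_cstM/stable_ratfun_XsubC/Re_pole.
Qed.

Lemma residue_mxB L L' : residue_mx L - residue_mx L' = residue_mx (L - L').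
Proof.
by rewrite /residue_mx transferB.
Qed.

Definition tangential_zero F :=
  forall i k, \sum_j ratfun_eval (F i j) (sigma 0 k) * R j k = 0.

(** On the imaginary axis the integrand is the real part of a single stable
    rational function of relative degree 2: there, conjugation moves the pole at
    -conj(sigma_k) to sigma_k, where the tangential zero of F cancels it. *)
Lemma h2_real_inner_residue F L : stable_mx F -> tangential_zero F ->
  h2_real_inner F (residue_mx L) = 0.
Proof.
move=> hF hz.
pose f i k := \sum_j ratfun_cst (R j k) * F i j.
have hf i k : stable_ratfun 1 (f i k).
  by apply: stable_ratfun_sum => j; apply: stable_ratfun_cstM.
have fE i k z : 0 <= complex.Re z ->
    has_value (f i k) z (\sum_j R j k * ratfun_eval (F i j) z).
  move=> z0; apply: has_value_sum => j; apply: has_valueM; first exact: has_value_cst.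
  exact: stable_ratfun_value (hF i j) z0.
have f0 i k : ratfun_eval (f i k) (sigma 0 k) = 0.
  rewrite (has_value_eval (fE _ _ _ (ltW (sigma_gt0 k)))) -[RHS](hz i k).
  by apply: eq_bigr => j _; rewrite mulrC.
pose phi := \sum_i \sum_k ratfun_cst (- Num.conj (L i k)) *
  (f i k / FracField.tofrac ('X - (sigma 0 k)%:P)).
have hphi : stable_ratfun 2 phi.
  do 2 (apply: stable_ratfun_sum => ?); apply: stable_ratfun_cstM.
  by apply: stable_ratfun_div_zero => //; exact: ltW.
rewrite -[RHS](Rintegral_stable_ratfun hphi); apply: eq_Rintegral => w _.
congr complex.Re; rewrite h2_integrandE.
set z := 0 +i* w.
have zs k : z != sigma 0 k.
  apply/eqP => e; have := sigma_gt0 k; rewrite -e ltxx //.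
have zp k : z != - Num.conj (sigma 0 k).
  apply/eqP => e; have := Re_pole k; rewrite -e ltxx //.
have phiE : has_value phi z (\sum_i \sum_k - Num.conj (L i k) *
    ((\sum_j R j k * ratfun_eval (F i j) z) * (z - sigma 0 k)^-1)).
  do 2 (apply: has_value_sum => ?); apply: has_valueM; first exact: has_value_cst.
  by apply: has_valueM; [exact: fE|exact: has_value_XsubC].
rewrite (has_value_eval phiE); apply: eq_bigr => i _.
have HE j : ratfun_eval (residue_mx L i j) z =
    \sum_k L i k * Num.conj (R j k) * (z - - Num.conj (sigma 0 k))^-1.
  apply: has_value_eval; rewrite residue_mxE; apply: has_value_sum => k.
  by apply: has_valueM; [exact: has_value_cst|exact: has_value_XsubC].
under eq_bigr do rewrite HE rmorph_sum mulr_sumr.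
rewrite exchange_big; apply: eq_bigr => k _ /=.
rewrite mulr_suml mulr_sumr; apply: eq_bigr => j _.
rewrite !rmorphM fmorphV rmorphB rmorphN /= !conjCK.
have -> : Num.conj z = - z 
  by rewrite /z conjC_conjc /=; apply/eqP; rewrite eq_complex /= oppr0 !eqxx.
have -> : - z - - sigma 0 k = - (z - sigma 0 k) by rewrite opprB opprK addrC.
by rewrite invrN; ring.
Qed.

End PoleResidueFamily.

(** * Nonsingularity of the Gramian *)

Section LyapunovGramian.
Variables (C : numClosedFieldType) (m q : nat).
Variables (sigma : 'rV[C]_q) (R : 'M[C]_(m, q)) (Gamma : 'M[C]_q).
Hypothesis sigma_inj : forall i j, sigma 0 i = sigma 0 j -> i = j.
Hypothesis sigma_sum_neq0 : forall i j, Num.conj (sigma 0 i) + sigma 0 j != 0.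
Hypothesis R_col_neq0 : forall j, col j R != 0.
Hypothesis lyapunov :
  (diag_mx sigma)^t* *m Gamma + Gamma *m diag_mx sigma = R^t* *m R.

Lemma lyapunov_entry i j :
  (Num.conj (sigma 0 i) + sigma 0 j) * Gamma i j = (R^t* *m R) i j.
Proof.
rewrite -lyapunov tr_diag_mx map_diag_mx mul_diag_mx mul_mx_diag !mxE; ring.
Qed.

Lemma lyapunov_hermitian : Gamma^t* = Gamma.
Proof.
apply/matrixP => i j; rewrite !mxE; apply: (mulfI (sigma_sum_neq0 i j)).
rewrite lyapunov_entry -{1}[sigma 0 j]conjCK addrC -rmorphD -rmorphM.
rewrite lyapunov_entry -[in RHS](trmxCK R) -adjmxM [in RHS]trmxCK.
by rewrite [in RHS]mxE [in RHS]mxE.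
Qed.

Lemma adj_mulmx_eq0 (u : 'rV[C]_m) : u *m u^t* = 0 -> u = 0.
Proof.
move=> /matrixP/(_ 0 0); rewrite !mxE => /eqP; rewrite psumr_eq0 => [/allP h|j _].
  apply/rowP => j; rewrite mxE; have := h j (mem_index_enum _).
  by rewrite !mxE mul_conjC_eq0 => /eqP.
by rewrite !mxE mul_conjC_ge0.
Qed.

(** If v Gamma = 0 then also Gamma v^* = 0, so the Lyapunov equation gives first
    v R^* R v^* = 0, hence v R^* = 0, and then v D^* Gamma = 0, where
    D = diag(sigma). *)
Lemma lyapunov_kernel (v : 'rV[C]_q) : v *m Gamma = 0 ->
  v *m R^t* = 0 /\ v *m (diag_mx sigma)^t* *m Gamma = 0.
Proof.
move=> v0; have v0' : Gamma *m v^t* = 0.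
  by rewrite -{1}lyapunov_hermitian -adjmxM v0 trmx0 map_mx0.
have vR : v *m R^t* = 0.
  apply: adj_mulmx_eq0; rewrite adjmxM trmxCK mulmxA -(mulmxA v) -lyapunov.
  by rewrite mulmxDr mulmxDl !mulmxA v0 !mul0mx addr0 -!mulmxA v0' !mulmx0.
split=> //; have := congr1 (mulmx v) lyapunov.
by rewrite mulmxDr !mulmxA v0 vR !mul0mx addr0.
Qed.

(** The left kernel is invariant under diag(sigma)^*, whose entries are
    distinct, so a nonzero vector in it can be filtered to a single coordinate;
    the corresponding column of R is then zero. *)
Lemma lyapunov_unit : Gamma \in unitmx.
Proof.
rewrite unitmxE unitfE; apply/negP => /det0P [v v0 vG].
have [i vi] : exists i, v 0 i != 0.
  apply/existsP; apply: contraR v0; rewrite negb_exists => /forallP h.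
  by apply/eqP/rowP => j; rewrite mxE; apply/eqP/negPn.
(* [w s] is [v] times a product of matrices diag(sigma)^* - conj(sigma_l); it
   kills the coordinates listed in [s]. *)
pose w (s : seq 'I_q) : 'rV[C]_q :=
  \row_k (v 0 k * \prod_(l <- s) (Num.conj (sigma 0 k) - Num.conj (sigma 0 l))).
have wG s : w s *m Gamma = 0.
  elim: s => [|l s ih].
    by rewrite (_ : w _ = v) //; apply/rowP => k; rewrite mxE big_nil mulr1.
  rewrite (_ : w _ = w s *m (diag_mx sigma)^t* - Num.conj (sigma 0 l) *: w s).
    by rewrite mulmxBl (lyapunov_kernel ih).2 -scalemxAl ih scaler0 subr0.
  apply/rowP => k; rewrite tr_diag_mx map_diag_mx mul_mx_diag !mxE big_cons; ring.
pose s := [seq l <- index_enum 'I_q | l != i].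
have ws k : k != i -> w s 0 k = 0.
  move=> ki; rewrite mxE (big_rem k) /=; first by rewrite subrr mul0r mulr0.
  by rewrite mem_filter ki mem_index_enum.
have wi : w s 0 i != 0.
  rewrite mxE mulf_neq0 // prodf_seq_neq0; apply/allP => l; rewrite mem_filter => /andP[li _].
  apply/implyP => _; rewrite subr_eq0; apply: contra_neq li.
  by move=> /(inv_inj (@conjCK C))/sigma_inj ->.
have [wR _] := lyapunov_kernel (wG s).
have /eqP := R_col_neq0 i; apply; apply/colP => j; rewrite !mxE.
move: wR => /rowP/(_ j); rewrite !mxE (bigD1 i) //= big1 ?addr0; last first.
  by move=> k ki; rewrite ws // mul0r.
by move=> /eqP; rewrite mulf_eq0 (negPf wi) !mxE conjC_eq0 => /eqP.
Qed.

End LyapunovGramian.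

(** * Pseudo-optimality *)

(** Diagonalizing S by T turns R into R T^-1. *)
Lemma residue_mx_family (K : realType) p m q (T : 'M[K[i]]_q) (S : 'M[K[i]]_q)
    (sigma : 'rV[K[i]]_q) (R : 'M[K[i]]_(m, q)) (L : 'M[K[i]]_(p, q)) :
  T \in unitmx -> S = invmx T *m diag_mx sigma *m T ->
  transfer 1%:M (- S^t*) (R^t*) L = residue_mx sigma (R *m invmx T) (L *m T^t*).
Proof.
move=> uT ->; have uT' : T^t* \in unitmx by rewrite adjmx_unit.
rewrite /residue_mx !adjmxM adjmx_invmx.
have uV : invmx (T^t*) \in unitmx by rewrite unitmx_inv.
have := @transfer_equiv K q m p (T^t*) 1%:M (- (diag_mx sigma)^t*) (invmx (T^t*))
  (R^t*) L uT' uV (det_pencil1 _).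
rewrite mulmx1 (mulmxV uT') invmxK => <-.
have -> : T^t* *m (- (diag_mx sigma)^t*) *m invmx (T^t*) =
  - (T^t* *m ((diag_mx sigma)^t* *m invmx (T^t*))) by rewrite mulmxN mulNmx mulmxA.
reflexivity.
Qed.

Theorem mainTheorem3 (K : realType) (n m p q : nat)
    (E A : 'M[K]_n) (B : 'M[K]_(n, m)) (C : 'M[K]_(p, n))
    (S : 'M[K[i]]_q) (R : 'M[K[i]]_(m, q))
    (sigma : 'rV[K[i]]_q) (T : 'M[K[i]]_q)
    (V : 'M[K[i]]_(n, q)) (Gamma : 'M[K[i]]_q) :
  let Ec := map_mx (real_complex K) E in
  let Ac := map_mx (real_complex K) A in
  let Bc := map_mx (real_complex K) B in
  let Cc := map_mx (real_complex K) C in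
  let G := transfer Ec Ac Bc Cc in
  regular_pencil Ec Ac ->
  asymptotically_stable Ec Ac ->
  strictly_proper G ->
  (forall i j, sigma 0 i = sigma 0 j -> i = j) ->
  (forall i, 0 < complex.Re (sigma 0 i)) ->
  T \in unitmx ->
  T *m S *m invmx T = diag_mx sigma ->
  (forall j, col j (R *m invmx T) != 0) ->
  Ac *m V - Ec *m V *m S - Bc *m R = 0 ->
  S^t* *m Gamma + Gamma *m S - R^t* *m R = 0 ->
  let Er := Gamma in
  let Ar := - S^t* *m Gamma in
  let Br := - R^t* in
  let Cr := Cc *m V in
  let Gr := transfer Er Ar Br Cr in
  h2_pseudo_optimal G (- S^t*) (R^t*) Gr /\
  (forall G', h2_pseudo_optimal G (- S^t*) (R^t*) G' -> G' = Gr).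
Proof.
move=> Ec Ac Bc Cc G reg stab sprop sinj spos uT TS Rcol sylv lyap Er Ar Br Cr Gr.
pose R' := R *m invmx T.
have ST : S *m invmx T = invmx T *m diag_mx sigma.
  by rewrite -TS !mulmxA mulVmx // mul1mx.
have SE : S = invmx T *m diag_mx sigma *m T by rewrite -ST mulmxKV.
have sneq i j : Num.conj (sigma 0 i) + sigma 0 j != 0 by exact: conj_add_neq0.
(* the Gramian in eigenvector coordinates *)
pose Gamma' := (invmx T)^t* *m Gamma *m invmx T.
have uGamma : Gamma \in unitmx.
  have : Gamma' \in unitmx.
    apply: (lyapunov_unit sinj sneq Rcol).
    have p1 : (diag_mx sigma)^t* *m (invmx T)^t* = (invmx T)^t* *m S^t*.
      by rewrite -!adjmxM ST.
    have -> : (diag_mx sigma)^t* *m Gamma' = (invmx T)^t* *m (S^t* *m Gamma) *m invmx T.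
      by rewrite /Gamma' !mulmxA p1.
    have -> : Gamma' *m diag_mx sigma = (invmx T)^t* *m (Gamma *m S) *m invmx T.
      by rewrite /Gamma' -!mulmxA ST.
    rewrite -mulmxDl -mulmxDr.
    move: lyap => /eqP; rewrite subr_eq0 => /eqP ->.
    by rewrite adjmxM !mulmxA.
  by rewrite /Gamma' !unitmx_mul => /andP[/andP[]].
have famE (L : 'M[K[i]]_(p, q)) :
    transfer 1%:M (- S^t*) (R^t*) L = residue_mx sigma R' (L *m T^t*).
  exact: residue_mx_family.
pose Lr := - (Cr *m invmx Gamma).
have GrE : Gr = transfer 1%:M (- S^t*) (R^t*) Lr.
  rewrite /Lr -transferN /Gr /Er /Ar /Br.
  have := @transfer_equiv K q m p 1%:M 1%:M (- S^t*) Gamma (- R^t*) Cr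
    (unitmx1 _ _) uGamma (det_pencil1 _).
  rewrite invmx1 (mul1mx 1%:M) (mul1mx Gamma) (mul1mx (- S^t*)) (mul1mx (- R^t*)).
  exact.
have GS : stable_mx G by exact: transfer_stable.
have famS (L : 'M[K[i]]_(p, q)) : stable_mx (transfer 1%:M (- S^t*) (R^t*) L).
  by rewrite famE; exact: residue_mx_stable.
have FS : stable_mx (G - Gr) by rewrite GrE; apply: stable_mxB.
have tz : tangential_zero sigma R' (G - Gr).
  move=> i k.
  pose t := col k (invmx T).
  have St : S *m t = sigma 0 k *: t.
    by rewrite /t !colE mulmxA ST -!colE mul_mx_diag; apply/colP => a; rewrite !mxE mulrC.
  have Rt j : (R *m t) j 0 = R' j k by rewrite /t colE mulmxA -colE mxE.
  have sk : 0 <= complex.Re (sigma 0 k) by exact: ltW.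
  have uG : sigma 0 k *: Ec - Ac \in unitmx.
    rewrite unitmxE unitfE -det_pencil_horner.
    exact: (stable_poly_horner (stable_poly_det_pencil stab) sk).
  (* sigma_k + S^* is similar to diag(sigma_k + conj(sigma_l)). *)
  have uGr : sigma 0 k *: Er - Ar \in unitmx.
    rewrite /Er /Ar mulNmx opprK -{1}(mul1mx Gamma) scalemxAl -mulmxDl unitmx_mul uGamma andbT.
    have -> : sigma 0 k *: 1%:M + S^t* =
        T^t* *m diag_mx (\row_l (sigma 0 k + Num.conj (sigma 0 l))) *m invmx (T^t*).
      rewrite SE !adjmxM adjmx_invmx mulmxA.
      have -> : diag_mx (\row_l (sigma 0 k + Num.conj (sigma 0 l))) =
          sigma 0 k *: 1%:M + (diag_mx sigma)^t*.
        rewrite tr_diag_mx map_diag_mx scalemx1 -diag_const_mx -raddfD; congr diag_mx.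
        by apply/rowP => l; rewrite !mxE.
      by rewrite mulmxDr mulmxDl -scalemxAr mulmx1 -scalemxAl mulmxV // adjmx_unit.
    rewrite !unitmx_mul unitmx_inv adjmx_unit uT andbT /= unitmxE det_diag unitfE.
    by rewrite prodf_seq_neq0; apply/allP => l _; rewrite mxE addrC sneq.
  have tG : \sum_j ratfun_eval (G i j) (sigma 0 k) * (R *m t) j 0 = - (Cc *m (V *m t)) i 0.
    apply: transfer_tangential => //.
    have := congr1 (mulmx^~ t) sylv; rewrite mul0mx !mulmxBl -!mulmxA St -!scalemxAr.
    by move=> /eqP; rewrite subr_eq0 => /eqP.
  (* The Lyapunov equation applied to t, read for the realization of Gr. *)
  have tGr : \sum_j ratfun_eval (Gr i j) (sigma 0 k) * (R *m t) j 0 = - (Cr *m t) i 0.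
    apply: transfer_tangential => //.
    have := congr1 (mulmx^~ t) lyap; rewrite mul0mx mulmxBl mulmxDl -!mulmxA St -!scalemxAr.
    move=> /eqP; rewrite subr_eq0 => /eqP e.
    by rewrite /Ar /Er /Br !mulNmx -e opprD mulmxA.
  transitivity ((- (Cc *m (V *m t)) i 0) - (- (Cr *m t) i 0)); last first.
    by rewrite /Cr mulmxA subrr.
  rewrite -tG -tGr -sumrB; apply: eq_bigr => j _.
  have v1 := stable_ratfun_value (GS i j) sk.
  have v2 : has_value (Gr i j) (sigma 0 k) (ratfun_eval (Gr i j) (sigma 0 k)).
    by rewrite GrE; apply: stable_ratfun_value sk; exact: famS.
  have -> : (G - Gr) i j = G i j - Gr i j by rewrite !mxE.
  by rewrite (has_value_eval (has_valueB v1 v2)) Rt mulrBl.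
(* G - GM is the sum of G - Gr and of a member of the family. *)
have pyth GM : G_family (- S^t*) (R^t*) GM ->
    stable_mx (Gr - GM) /\
    h2_real_inner (G - GM) (G - GM) =
      h2_real_inner (G - Gr) (G - Gr) + h2_real_inner (Gr - GM) (Gr - GM).
  move=> [CM ->]; have HS : stable_mx (Gr - transfer 1%:M (- S^t*) (R^t*) CM).
    by rewrite GrE; apply: stable_mxB.
  split=> //; rewrite -(h2_real_inner_pythagoras FS HS) ?subrKA ?addrA ?subrK //.
  have -> : Gr - transfer 1%:M (- S^t*) (R^t*) CM =
      residue_mx sigma R' (Lr *m T^t* - CM *m T^t*) by rewrite GrE !famE residue_mxB.
  exact: h2_real_inner_residue.
have Gr_fam : G_family (- S^t*) (R^t*) Gr by exists Lr.
split; first split.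
- exact: (stable_mx_H2 GS).
- by move=> _ [CM ->]; exact: (stable_mx_H2 (famS CM)).
- exact: Gr_fam.
- move=> GM /pyth[_ e]; rewrite le_h2_norm e lerDl; exact: h2_real_inner_ge0.
move=> G' [_ _ /pyth[HS e] /(_ _ Gr_fam)]; rewrite le_h2_norm e.
rewrite gerDl => h; apply/esym/eqP; rewrite -subr_eq0; apply/eqP.
apply: (h2_real_inner_definite HS).
by apply/eqP; rewrite eq_le h h2_real_inner_ge0.
Qed.
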